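(* Let $n,\ell$ be integers with $1 \le \ell \le n$, let $\psi : \mathbb{Z}_{\ge 0} \to \mathbb{R}_{>0}$ be non-increasing, and let $f$ be a dimension function such that $r \mapsto r^{-n}f(r)$ is monotonically increasing and such that $g : r \mapsto r^{-(n-1)}f(r)$ is also a dimension function. Let $\mathcal{L}_{n,\ell}(\psi)$ be the set of $(\alpha_1,\dots,\alpha_n) \in \mathbb{R}^n$ such that $\Vert \alpha_1x_1 + \dots + \alpha_nx_n\Vert \le \psi(H(\underline{x}))$ for infinitely many $\underline{x} = (x_1,\dots,x_n) \in \mathbb{Z}^n$ with $\max\{|x_{\ell+1}|,\dots,|x_n|\} < \max\{|x_1|,\dots,|x_\ell|\}$ (void for $\ell=n$). Then $\mathcal{H}^f(\mathcal{L}_{n,\ell}(\psi)) = 0$ whenever $\sum_{r=1}^\infty r^n g(\psi(r)/r) < \infty$, and $\mathcal{H}^f(\mathcal{L}_{n,\ell}(\psi)) = \infty$ whenever $\sum_{r=1}^\infty r^n g(\psi(r)/r) = \infty$.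
   Context: $\Vert \cdot \Vert$ is the distance to the nearest integer; $H(\underline{x}) = \max_i|x_i|$. A dimension function is a continuous non-decreasing function $f : \mathbb{R}_{\ge 0} \to \mathbb{R}_{\ge 0}$ with $f(r) \to 0$ as $r \to 0$; $\mathcal{H}^f$ denotes the associated Hausdorff $f$-measure.
   Formalization: ''Monotonically increasing'' is read as r decreases to 0: r^{-n}f(r) is assumed non-increasing in r. With the literal direction the divergence claim fails, e.g. f(r)=r^{n+1}, ψ=1, where the set is R^n, its H^f-measure is 0 and the sum diverges. *)

(* Defs.v *)
From HB Require Import structures.
From mathcomp Require Import all_boot all_order all_algebra.
From mathcomp Require Import all_classical all_reals all_analysis.
Set Implicit Arguments.
Unset Strict Implicit.
Unset Printing Implicit Defensive.
Import Order.TTheory GRing.Theory Num.Theory.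
Import numFieldNormedType.Exports.
Local Open Scope classical_set_scope.
Local Open Scope ring_scope.

(* A function on the half-line [0, +oo[ is represented by a function on R, of
   which only the restriction to [0, +oo[ is constrained or used. *)
Definition dimension_function (R : realType) (f : R -> R) : Prop :=
  [/\ forall r, 0 <= r -> 0 <= f r,
      {within `[0, +oo[, continuous f},
      forall r s, 0 <= r -> r <= s -> f r <= f s
    & f r @[r --> 0^'+] --> (0 : R)].

(* The map r |-> r^-k f(r).  For k > 0 its value at r = 0 is 0, because
   0^-1 = 0; this is also the value at 0 that continuity of a dimension
   function forces. *)
Definition divpow (R : realType) (k : nat) (f : R -> R) (r : R) : R :=
  r ^- k * f r.

Section HausdorffMeasure.
Variables (R : realType) (n : nat).
Implicit Types (A U : set 'rV[R]_n) (f : R -> R).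

(* The norm that MathComp puts on 'rV[R]_n is the sup norm, hence this
   explicit Euclidean distance. *)
Definition euclidean_dist (x y : 'rV[R]_n) : R :=
  Num.sqrt (\sum_(i < n) (x ord0 i - y ord0 i) ^+ 2).

(* 0 is added to the set of distances so that the empty set has diameter 0
   instead of -oo. *)
Definition diam U : \bar R :=
  ereal_sup (0%E |` [set (euclidean_dist p.1 p.2)%:E | p in U `*` U]).

(* Covers are indexed by nat; finite covers are padded with empty sets, which
   contribute f 0 = 0.  [fine] is harmless since every diameter is at most
   delta. *)
Definition hausdorff_premeasure f (delta : R) A : \bar R :=
  ereal_inf [set (\sum_(0 <= i <oo) (f (fine (diam (U i))))%:E)%E | U in
    [set U : nat -> set 'rV[R]_n |
      A `<=` \bigcup_i U i /\ forall i, (diam (U i) <= delta%:E)%E]].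

Definition hausdorff_measure f A : \bar R :=
  ereal_sup [set hausdorff_premeasure f delta A | delta in [set d : R | 0 < d]].

End HausdorffMeasure.

Definition dist_int (R : realType) (t : R) : R :=
  inf [set `|t - m%:~R| | m in [set: int]].

Definition height (n : nat) (x : 'rV[int]_n) : nat :=
  \max_(i < n) `|x ord0 i|%N.

(* The first l coordinates are those of index i < l; for l = n there is no
   condition. *)
Definition head_dominant (n l : nat) (x : 'rV[int]_n) : Prop :=
  (l < n)%N ->
  (\max_(i < n | (l <= i)%N) `|x ord0 i|%N <
   \max_(i < n | (i < l)%N) `|x ord0 i|%N)%N.

Definition approximable_set (R : realType) (n l : nat) (psi : nat -> R) :
    set 'rV[R]_n :=
  [set a | infinite_set [set x : 'rV[int]_n | head_dominant l x /\
     dist_int (\sum_(i < n) a ord0 i * (x ord0 i)%:~R) <= psi (height x)]].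

(* Main.v *)
(** Convergence: cut each neighbourhood [|x.a - p| <= 2 psi(r)], [r = height x],
    inside a fixed box into sets of diameter of order [t = psi(r)/r].  About
    [r^n t^-(n-1)] of them are needed for all [x] of height [r], at total cost
    [r^n g(t)], and the Hausdorff-Cantelli argument applies.

    Divergence: only the vectors [x] whose first coordinate dominates are used.
    It suffices that no sequence of cubes [U_i] of radii [e_i] with
    [sum f(e_i) < oo] covers the set.  Call a cube [J] of radius [t] light if the
    [U_i] meeting it satisfy [sum f(e_i) <= eps f(t)].  Far away there is a light
    unit cube; a nested sequence of light cubes, centred on resonant hyperplanes
    of growing height, shrinks to a point of the set lying in no [U_i].  To pass
    from a light cube [J] to a smaller one, put [lam = t^n/f(t)] and widen the
    hyperplanes of level [k] (heights about [B^k]) to width [lam g(rho_k)].  By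
    Dirichlet's theorem and a second moment estimate, finitely many levels
    cover a fixed proportion of [J].  If none of the candidate cubes were light,
    this proportion would be covered by the fattened large [U_i] together with
    the fattenings of a Vitali family of candidates carrying many small [U_i],
    and both have volume at most a small multiple of [eps t^n].  All volumes are
    counted on the points of a fine grid, one coordinate direction being singled
    out. *)
Require Import Defs.
From HB Require Import structures.
From mathcomp Require Import all_boot all_order all_algebra.
From mathcomp Require Import all_classical all_reals all_analysis.
From mathcomp Require Import ring lra zify.
Set Implicit Arguments.
Unset Strict Implicit.
Unset Printing Implicit Defensive.
Import Order.TTheory GRing.Theory Num.Theory.
Import numFieldNormedType.Exports.
Local Open Scope classical_set_scope.
Local Open Scope ring_scope.

(** * Counting grid points *)

(** The members of [P] lie between its smallest and its largest index, which are at most [L]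
    apart. *)
Lemma card_window (R : realType) (D : nat) (P : pred 'I_D) (L : R) :
  0 <= L -> (forall i j, P i -> P j -> j%:R - i%:R <= L) ->
  #|P|%:R <= L + 1.
Proof.
move=> L0 PL; case: (pickP P) => [i0 Pi0|P0]; last first.
  by rewrite (eq_card0 P0); lra.
case: (arg_minnP (fun i : 'I_D => i : nat) Pi0) => i Pi mini.
case: (arg_maxnP (fun i : 'I_D => i : nat) Pi0) => j Pj maxj.
have: (#|P| <= (j - i).+1)%N.
  rewrite cardE -(size_map val) -[leqRHS](size_iota i).
  apply: uniq_leq_size; first by rewrite map_inj_uniq ?enum_uniq //; exact: val_inj.
  move=> x /mapP[y]; rewrite mem_enum => Py ->; rewrite mem_iota.
  have := mini _ Py; have := maxj _ Py; rewrite /=; lia.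
rewrite -(ler_nat R) => /le_trans; apply.
rewrite -natr1 lerD2r natrB; last exact: mini.
exact: PL.
Qed.

Lemma card_near_le (R : realType) (D : nat) (h o v r : R) : 0 < h -> 0 <= r ->
  #|[pred i : 'I_D | `|o + h * i%:R - v| <= r]|%:R <= 2 * r / h + 1.
Proof.
move=> h0 r0; apply: card_window; first by apply: divr_ge0; lra.
move=> i j /=; rewrite !ler_norml => /andP[i1 i2] /andP[j1 j2].
rewrite ler_pdivlMr//; nra.
Qed.

(** Only points on the left of [v] are used: if [I] indexes the last grid point not beyond [v] and
    [K] is the integer part of [r / h], the indices [I - j] with [j < K] qualify, and
    [r / h < K + 1 <= 2 * K]. *)
Lemma card_near_ge (R : realType) (D : nat) (h o v r : R) :
  0 < h -> 2 * h <= r -> o + r <= v -> v < o + h * D%:R ->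
  r / (2 * h) <= #|[pred i : 'I_D | `|o + h * i%:R - v| <= r]|%:R.
Proof.
move=> h0 hr vr vD.
have q0 : 0 <= (v - o) / h by apply: divr_ge0; lra.
have r0 : 0 <= r / h by apply: divr_ge0; lra.
have /andP[] := truncn_itv q0; set I := Num.trunc _.
rewrite ler_pdivlMr// ltr_pdivrMr// -natr1 => I1 I2.
have /andP[] := truncn_itv r0; set K := Num.trunc _.
rewrite ler_pdivlMr// ltr_pdivrMr// -natr1 => K1 K2.
have ID : (I < D)%N.
  rewrite -(ltr_nat R) -(ltr_pM2r h0); lra.
have KI : (K <= I.+1)%N.
  rewrite -(ler_nat R) -natr1 -(ler_pM2r h0); lra.
have K0 : (0 < K)%N.
  by rewrite -(ltr_nat R) -(ltr_pM2r h0); lra.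
have KD (j : 'I_K) : (I - j < D)%N by lia.
pose F (j : 'I_K) := Ordinal (KD j).
have Finj : injective F.
  move=> j1 j2 /(congr1 val)/= e; apply: val_inj => /=.
  have := ltn_ord j1; have := ltn_ord j2; lia.
apply: (@le_trans _ _ K%:R).
  rewrite ler_pdivrMr; last by lra.
  have : 1 <= K%:R :> R by rewrite ler1n.
  nra.
rewrite ler_nat -[leqLHS]card_ord -(card_codom Finj).
apply: subset_leq_card; apply/fintype.subsetP => _ /codomP[j ->].
rewrite inE /=.
have jK := ltn_ord j.
rewrite natrB; last by lia.
have j1 : (j : nat)%:R + 1 <= K%:R :> R by rewrite natr1 ler_nat.
have j0 : 0 <= (j : nat)%:R :> R by [].
by rewrite ler_norml; apply/andP; split; nra.
Qed.

(** The values [b + xi * v] sweep an interval of length at most [|xi| * D], near which there are at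
    most [|xi| * D + 5] integers; [card_near_le] bounds the number of [v] close to each of them. *)
Lemma card_near_int (R : realType) (D : nat) (b xi eta : R) :
  xi != 0 -> 0 <= eta -> eta <= 1 ->
  #|[pred v : 'I_D | `[< exists p : int, `|b + xi * v%:R - p%:~R| <= eta >]]|%:R
  <= (`|xi| * D%:R + 5) * (2 * eta / `|xi| + 1).
Proof.
wlog xi0 : b xi / 0 < xi => [H xin0 e0 e1|_ e0 e1].
  have [xi0|xi0] := leP xi 0; last exact: H.
  have -> : `|xi| = `|- xi| by rewrite normrN.
  rewrite (@eq_card _ _ [pred v : 'I_D |
    `[< exists p : int, `|- b + (- xi) * v%:R - p%:~R| <= eta >]]).
    by apply: H; rewrite ?oppr_eq0// oppr_gt0 lt_neqAle xin0.
  move=> v; rewrite !inE; apply: asbool_equiv_eq; split => -[p Hp]; exists (- p);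
    rewrite mulrNz -normrN; apply: le_trans Hp; rewrite le_eqVlt; apply/orP; left;
    by apply/eqP; congr `|_|; ring.
rewrite gtr0_norm//.
have xD0 : 0 <= xi * D%:R by rewrite mulr_ge0// ltW.
(* As [eta <= 1], no integer below [p0] comes within [eta] of a value. *)
set p0 := Num.floor (b - 1).
have /andP[p01 p02] := floor_itv (b - 1); rewrite -/p0 intrD in p01 p02.
set P := (Num.trunc (xi * D%:R)).+4.+1.
have /andP[P1 P2] := truncn_itv xD0.
have PE : P%:R = (Num.trunc (xi * D%:R))%:R + 5 :> R by rewrite /P -!natr1; lra.
pose W (q : 'I_P) := [pred v : 'I_D | `|b + xi * v%:R - (p0%:~R + q%:R)| <= eta].
have sub : {subset [pred v : 'I_D | `[< exists p : int,
    `|b + xi * v%:R - p%:~R| <= eta >]] <= [pred v | [exists q : 'I_P, W q v]]}.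
  move=> v; rewrite !inE => -[p]; rewrite ler_norml => /andP[h1 h2].
  have vD : v%:R <= D%:R :> R by rewrite ler_nat ltnW.
  have v0 : 0 <= xi * v%:R by rewrite mulr_ge0// ltW.
  have vD' : xi * v%:R <= xi * D%:R by rewrite ler_pM2l.
  have pp0 : (p0 <= p).
    by rewrite -(ler_int R); lra.
  have eqp : (`|p - p0|%N)%:R = p%:~R - p0%:~R :> R.
    by rewrite -intrB -[X in X%:~R](gez0_abs) ?subr_ge0.
  have qP : (`|p - p0| < P)%N.
    rewrite -(ltr_nat R) eqp PE -natr1 in P2 *; lra.
  apply/existsP; exists (Ordinal qP); rewrite inE /= eqp.
  by rewrite ler_norml; apply/andP; split; lra.
apply: (@le_trans _ _ (\sum_(q < P) #|W q|%:R)).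
  rewrite -natr_sum ler_nat.
  move/fintype.subsetP: sub => /subset_leq_card /leq_trans; apply.
  rewrite -sum1_card; under [leqRHS]eq_bigr do rewrite -sum1_card big_mkcond.
  rewrite exchange_big /= big_mkcond /=; apply: leq_sum => v _.
  case: ifP => //; rewrite inE => /existsP[q Wq].
  by rewrite (bigD1 q)//= inE Wq.
apply: (@le_trans _ _ (\sum_(q < P) (2 * eta / xi + 1))).
  apply: ler_sum => q _.
  exact: card_near_le.
rewrite sumr_const card_ord -[leLHS]mulr_natl ler_wpM2r//; last by rewrite PE; lra.
by apply: addr_ge0 => //; apply: divr_ge0; lra.
Qed.

(** * Changing one coordinate of a grid point *)

Definition upd (I : finType) (X : Type) (a : {ffun I -> X}) (i : I) (v : X) :
    {ffun I -> X} :=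
  [ffun j => if j == i then v else a j].

Lemma updE (I : finType) (X : Type) (a : {ffun I -> X}) (i : I) (v : X) :
  upd a i v i = v.
Proof. by rewrite ffunE eqxx. Qed.

Lemma updN (I : finType) (X : Type) (a : {ffun I -> X}) (i j : I) (v : X) :
  j != i -> upd a i v j = a j.
Proof. by rewrite ffunE => /negbTE ->. Qed.

Lemma upd_upd (I : finType) (X : Type) (a : {ffun I -> X}) (i : I) (v w : X) :
  upd (upd a i v) i w = upd a i w.
Proof. by apply/ffunP => j; rewrite !ffunE; case: (j == i). Qed.

Lemma upd_id (I : finType) (X : Type) (a : {ffun I -> X}) (i : I) :
  upd a i (a i) = a.
Proof. by apply/ffunP => j; rewrite !ffunE; case: eqP => [->|]. Qed.

(* [(a, v) |-> (upd a i v, a i)] is an involution. *)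
Lemma sum_upd (R : nmodType) (I X : finType) (i : I)
    (F : {ffun I -> X} -> X -> R) :
  \sum_a \sum_v F (upd a i v) (a i) = \sum_a \sum_v F a v.
Proof.
pose phi (p : {ffun I -> X} * X) := (upd p.1 i p.2, p.1 i).
have phiK : involutive phi.
  by move=> [a v]; rewrite /phi /= ?upd_upd ?updE ?upd_id.
rewrite !pair_big /= [RHS](reindex_inj (inv_inj phiK)) /=.
exact: eq_bigr.
Qed.

(** Fubini on the grid: [P] is counted along the lines in direction [i], each line being visited
    once per point on it, whence the factor [#|X|]. *)
Lemma card_fiber (R : realType) (I X : finType) (i : I)
    (P : pred {ffun I -> X}) (M : R) :
  (forall a, #|[pred v | P (upd a i v)]|%:R <= M) ->
  #|X|%:R * #|P|%:R <= #|{ffun I -> X}|%:R * M.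
Proof.
move=> PM; rewrite mulrC.
have -> : #|P|%:R * #|X|%:R = \sum_a \sum_(v : X) (P a)%:R :> R.
  under eq_bigr do rewrite sumr_const -[_ *+ #|_|]mulr_natr.
  by rewrite -mulr_suml -natr_sum -(sum1_card P) [in LHS]big_mkcond.
have /= <- := sum_upd i (fun a (_ : X) => (P a)%:R : R).
apply: (@le_trans _ _ (\sum_(a : {ffun I -> X}) M)); last first.
  by rewrite sumr_const -[leLHS]mulr_natl.
apply: ler_sum => a _; apply: le_trans (PM a).
by rewrite -natr_sum ler_nat -sum1_card [leqRHS]big_mkcond.
Qed.

Lemma card_box (R : realType) (I : finType) (D : nat) (h : R) (o v r : I -> R) :
  0 < h -> (forall i, 0 <= r i) ->
  #|[pred a : {ffun I -> 'I_D} |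
     [forall i, `|o i + h * (a i)%:R - v i| <= r i]]|%:R
  <= \prod_i (2 * r i / h + 1).
Proof.
move=> h0 r0.
pose F i := [pred x : 'I_D | `|o i + h * x%:R - v i| <= r i].
rewrite (@eq_card _ _ (family F)); last first.
  by move=> a; rewrite !inE; apply: eq_forallb.
rewrite card_family foldrE big_map natr_prod big_enum /=.
apply: ler_prod => i _; rewrite ler0n /=; exact: card_near_le.
Qed.

(** Cauchy-Schwarz on the support of [S]: with [N] its size and [T1] the total, expand the sum of
    [(N * S a - T1) ^+ 2]. Moment bounds thus give a lower bound for the support. *)
Lemma paley_zygmund (R : realType) (T : finType) (S : T -> R) :
  (\sum_a S a) ^+ 2 <= #|[pred a | S a != 0]|%:R * \sum_a S a ^+ 2.
Proof.
set P := [pred a | _]; set N := #|P|%:R.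
have -> : \sum_a S a = \sum_(a | P a) S a.
  rewrite [LHS](bigID P)/= [X in _ + X]big1 ?addr0// => a; rewrite negbK.
  by move=> /eqP.
have -> : \sum_a S a ^+ 2 = \sum_(a | P a) S a ^+ 2.
  rewrite [LHS](bigID P)/= [X in _ + X]big1 ?addr0// => a; rewrite negbK.
  by move=> /eqP ->; rewrite expr0n.
set T1 := \sum_(a | _) _; set Q := \sum_(a | _) _.
have [N0|N0] := eqVneq N 0.
  rewrite N0 mul0r /T1 big1 ?expr0n//= => a Pa.
  have := N0 => /eqP; rewrite pnatr_eq0 => /eqP /card0_eq /(_ a).
  by rewrite inE Pa.
have N1 : 0 < N by rewrite lt_neqAle eq_sym N0 ler0n.
have : 0 <= \sum_(a | P a) (N * S a - T1) ^+ 2.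
  by apply: sumr_ge0 => a _; exact: sqr_ge0.
rewrite (eq_bigr (fun a => N ^+ 2 * S a ^+ 2 - 2 * N * T1 * S a + T1 ^+ 2));
  last by move=> a _; ring.
rewrite big_split /= sumrB -!mulr_sumr sumr_const -/Q -/T1 -[_ *+ #|_|]mulr_natl -/N => H.
by rewrite -(ler_pM2l N1) -subr_ge0; apply: le_trans H _; lra.
Qed.

(** * Dirichlet's theorem on a grid *)

Definition dot (R : realType) (n : nat) (a : 'I_n -> R) (x : 'rV[int]_n) : R :=
  \sum_i a i * (x ord0 i)%:~R.

Definition near_int (R : realType) (e t : R) : Prop :=
  exists p : int, `|t - p%:~R| <= e.

Definition gridpt (R : realType) (I : finType) (D : nat) (o : I -> R) (h : R)
    (a : {ffun I -> 'I_D}) (i : I) : R :=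
  o i + h * (a i)%:R.

Definition set_first (R : realType) (m : nat) (a : 'I_m.+1 -> R) (z : R)
    (i : 'I_m.+1) : R :=
  if i == ord0 then z else a i.

(** The line through [a] in the first direction crosses a rational hyperplane at [z]. The bounds on
    [x] make its first coordinate dominant, so that its absolute value is also the height. *)
Definition resonant (R : realType) (m : nat) (Q0 Q1 : nat) (a : 'I_m.+1 -> R)
    (z : R) : Prop :=
  exists (x : 'rV[int]_m.+1) (p : int),
    [/\ (Q0 < `|x ord0 ord0|)%N, (`|x ord0 ord0| <= Q1)%N,
        forall j, j != ord0 -> (`|x ord0 j| <= Q0)%N &
        dot (set_first a z) x = p%:~R].

Lemma card_cover (T : finType) (P A B : pred T) :
  (forall a, P a -> A a || B a) -> (#|P| <= #|A| + #|B|)%N.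
Proof.
move=> PAB; rewrite -cardUI; apply: leq_trans (leq_addr _ _).
by apply: subset_leq_card; apply/fintype.subsetP => a; rewrite !inE => /PAB.
Qed.

Lemma card_cover_sum (T I : finType) (P : pred T) (J : pred I)
    (A : I -> pred T) :
  (forall a, P a -> exists2 i, J i & A i a) ->
  (#|P| <= \sum_(i | J i) #|A i|)%N.
Proof.
move=> PA; rewrite -sum1_card; under [leqRHS]eq_bigr do rewrite -sum1_card big_mkcond.
rewrite exchange_big /= big_mkcond /=; apply: leq_sum => v _.
case: ifP => // /PA[i Ji Ai]; by rewrite (bigD1 i)//= [v \in _]Ai.
Qed.

(** Two of the fractional parts of [F] fall into the same one of [K] bins of length [1 / K]. *)
Lemma pigeonhole_int (R : realType) (X : finType) (F : X -> R) (K : nat) :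
  (0 < K)%N -> (K < #|X|)%N ->
  exists x y, x != y /\ near_int (K%:R^-1) (F x - F y).
Proof.
move=> K0 KX.
have KR : 0 < K%:R :> R by rewrite ltr0n.
pose fr x := F x - (Num.floor (F x))%:~R.
have fr0 x : 0 <= K%:R * fr x.
  by rewrite mulr_ge0// subr_ge0; have /andP[] := floor_itv (F x).
have fr1 x : fr x < 1.
  by rewrite ltrBlDl; have /andP[] := floor_itv (F x); rewrite intrD.
have binK x : (Num.trunc (K%:R * fr x) < K)%N.
  rewrite -(ltr_nat R); have /andP[+ _] := truncn_itv (fr0 x).
  by move=> /le_lt_trans; apply; rewrite -[ltRHS]mulr1 ltr_pM2l.
pose bin x := Ordinal (binK x).
have : ~~ injectiveb bin.
  apply/negP => /injectiveP /leq_card; rewrite card_ord; lia.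
move=> /injectivePn[x [y xy exy]]; exists x, y; split => //.
exists (Num.floor (F x) - Num.floor (F y)).
have /andP[x1 x2] := truncn_itv (fr0 x).
have /andP[y1 y2] := truncn_itv (fr0 y).
have e : Num.trunc (K%:R * fr x) = Num.trunc (K%:R * fr y) by have [] := exy.
rewrite e -natr1 in x1 x2; rewrite -natr1 in y2.
have -> : F x - F y - (Num.floor (F x) - Num.floor (F y))%:~R = fr x - fr y.
  by rewrite intrB /fr; ring.
rewrite -[leRHS]mul1r ler_pdivlMr// -[X in _ * X]gtr0_norm// -normrM.
by rewrite ler_norml; apply/andP; split; nra.
Qed.

(** Pigeonhole on a box with [B * Q + 1] values for the first coordinate and [Q + 1] for each other
    one. The extra factor [B] is what makes the first coordinate dominate for most points. *)
Lemma dirichlet (R : realType) (m Q B : nat) (a : 'I_m.+1 -> R) :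
  (0 < Q)%N -> (0 < B)%N ->
  exists x : 'rV[int]_m.+1,
    [/\ x != 0, (`|x ord0 ord0| <= B * Q)%N,
        forall j, j != ord0 -> (`|x ord0 j| <= Q)%N &
        near_int ((B * Q ^ m.+1)%N%:R^-1) (dot a x)].
Proof.
move=> Q0 B0.
pose X := ('I_(B * Q).+1 * {ffun 'I_m -> 'I_Q.+1})%type.
pose V (w : X) : 'rV[int]_m.+1 :=
  \row_i (if unlift ord0 i is Some j then (w.2 j)%:Z else (w.1)%:Z).
have [||w1 [w2 [w12 nw]]] := @pigeonhole_int R X (fun w => dot a (V w)) (B * Q ^ m.+1).
- by rewrite muln_gt0 B0 expn_gt0 Q0.
- rewrite card_prod card_ord card_ffun !card_ord expnS mulnA.
  apply: (@leq_trans ((B * Q).+1 * Q ^ m)); last by case: (m) => [|m']; rewrite ?expn0 //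
    leq_mul2l leq_exp2r// leqnSn orbT.
  by rewrite ltn_mul2r expn_gt0 Q0 ltnS leqnn.
exists (V w1 - V w2); split.
- rewrite subr_eq0; apply: contra w12 => /eqP/rowP e; apply/eqP.
  rewrite [w1]surjective_pairing [w2]surjective_pairing; congr pair.
    have := e ord0; rewrite !mxE unlift_none => -[] /val_inj; exact.
  apply/ffunP => j; have := e (lift ord0 j); rewrite !mxE liftK => -[] /val_inj; exact.
- rewrite !mxE unlift_none.
  have := ltn_ord w1.1; have := ltn_ord w2.1.
  move: (nat_of_ord w1.1) (nat_of_ord w2.1) => u v; lia.
- move=> j; rewrite !mxE; case: unliftP => [i _ _|-> /eqP//].
  have := ltn_ord (w1.2 i); have := ltn_ord (w2.2 i).
  move: (nat_of_ord (w1.2 i)) (nat_of_ord (w2.2 i)) => u v; lia.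
- suff -> : dot a (V w1 - V w2) = dot a (V w1) - dot a (V w2) by [].
  rewrite /dot -sumrB; apply: eq_bigr => i _.
  by rewrite !mxE intrB mulrBr.
Qed.

(** [card_near_int] is applied on each line in direction [i]. Since [e] is at least the change of
    the form over one grid step, the [+ 1] of that count is absorbed into the constant [3]. *)
Lemma card_near_hyperplane (R : realType) (n D : nat) (o : 'I_n -> R) (h e : R)
    (x : 'rV[int]_n) (i : 'I_n) :
  (0 < D)%N -> 0 < h -> x ord0 i != 0 -> `|x ord0 i|%N%:R * h <= e -> e <= 1 ->
  #|[pred a : {ffun 'I_n -> 'I_D} | `[< near_int e (dot (gridpt o h a) x) >]]|%:R
  <= D%:R ^+ n * (3 * e * (1 + 5 / (`|x ord0 i|%N%:R * (h * D%:R)))).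
Proof.
move=> D0 h0 xi0 xie e1.
set X : R := `|x ord0 i|%N%:R.
have X1 : 1 <= X by rewrite ler1n absz_gt0.
have DR : 0 < D%:R :> R by rewrite ltr0n.
have XE : `|h * (x ord0 i)%:~R| = X * h.
  by rewrite normrM gtr0_norm// mulrC -intr_norm /X natr_absz.
have Xh : 0 < X * h by rewrite mulr_gt0//; lra.
have e0 : 0 <= e by rewrite -/X in xie; lra.
have := @card_fiber R _ 'I_D i
  [pred a | `[< near_int e (dot (gridpt o h a) x) >]]
  ((X * h * D%:R + 5) * (2 * e / (X * h) + 1)).
rewrite card_ffun !card_ord natrX => H.
have {H}/H : forall a : {ffun 'I_n -> 'I_D},
  #|[pred v | [pred a | `[< near_int e (dot (gridpt o h a) x) >]] (upd a i v)]|%:R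
  <= (X * h * D%:R + 5) * (2 * e / (X * h) + 1).
  move=> a; rewrite -XE.
  pose b := \sum_(j | j != i) gridpt o h a j * (x ord0 j)%:~R + o i * (x ord0 i)%:~R.
  have := @card_near_int R D b (h * (x ord0 i)%:~R) e.
  rewrite mulf_neq0 ?intr_eq0// ?gt_eqF// => /(_ isT e0 e1).
  congr (_%:R <= _); apply: eq_card => v; rewrite !inE; apply: asbool_equiv_eq.
  suff -> : dot (gridpt o h (upd a i v)) x = b + h * (x ord0 i)%:~R * v%:R by [].
  rewrite /dot (bigD1 i)//= addrC /b -addrA; congr +%R.
    by apply: eq_bigr => j ji; rewrite /gridpt updN.
  by rewrite /gridpt updE; ring.
rewrite mulrC -ler_pdivlMr// => /le_trans; apply.
rewrite -[leLHS]mulrA ler_wpM2l ?exprn_ge0//.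
have Xe : 1 <= e / (X * h) by rewrite ler_pdivlMr// mul1r.
apply: (@le_trans _ _ ((X * h * D%:R + 5) * (3 * (e / (X * h))) / D%:R)).
  rewrite ler_wpM2r ?invr_ge0// ler_wpM2l//; first by nra.
  rewrite -[2 * e / _]mulrA; lra.
rewrite le_eqVlt; apply/orP; left; apply/eqP; field.
by rewrite !gt_eqF//; lra.
Qed.

Definition box_vec (n Q : nat) (w : {ffun 'I_n -> 'I_(2 * Q).+1}) : 'rV[int]_n :=
  \row_i ((w i)%:Z - Q%:Z).

(** The points for which the vector of Dirichlet's theorem may have all entries at most [Q], so that
    its first coordinate need not dominate. *)
Definition exceptional (R : realType) (n Q : nat) (e : R) (a : 'I_n -> R) : Prop :=
  exists2 x : 'rV[int]_n, x != 0 &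
    (forall i, `|x ord0 i| <= Q)%N /\ near_int e (dot a x).

Lemma absz_shift (z : int) (Q : nat) :
  (`|z| <= Q)%N -> (absz (z + Q%:Z))%:Z - Q%:Z = z.
Proof. by lia. Qed.

(** Union bound over the vectors of the box. A vector with an entry above [5 / t], where
    [t = h * D], takes a proportion of at most [6 * e]; the others cost more, but their number does
    not depend on [Q]. *)
Lemma card_exceptional (R : realType) (n D Q : nat) (o : 'I_n -> R) (h e : R) :
  (0 < D)%N -> 0 < h -> Q%:R * h <= e -> e <= 1 ->
  #|[pred a : {ffun 'I_n -> 'I_D} | `[< exceptional Q e (gridpt o h a) >]]|%:R
  <= D%:R ^+ n * (6 * e * (2 * Q%:R + 1) ^+ n +
       (2 * (Num.trunc (5 / (h * D%:R))).+1%:R + 1) ^+ n *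
       (3 * e * (1 + 5 / (h * D%:R)))).
Proof.
move=> D0 h0 Qe e1; set t := h * D%:R; set K := (Num.trunc (5 / t)).+1.
have t0 : 0 < t by rewrite mulr_gt0 ?ltr0n.
have e0 : 0 <= e by apply: le_trans Qe; rewrite mulr_ge0// ltW.
have t5 : 0 <= 5 / t by rewrite divr_ge0// ltW.
have DR : 0 <= D%:R ^+ n :> R by rewrite exprn_ge0.
pose N (w : {ffun 'I_n -> 'I_(2 * Q).+1}) :=
  [pred a : {ffun 'I_n -> 'I_D} | `[< near_int e (dot (gridpt o h a) (box_vec w)) >]].
pose small := [pred w : {ffun 'I_n -> 'I_(2 * Q).+1} |
  [forall i, `|0 + 1 * (w i)%:R - Q%:R| <= K%:R :> R]].
have NE w (x := box_vec w) (i : 'I_n) : x ord0 i != 0 ->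
    #|N w|%:R <= D%:R ^+ n * (3 * e * (1 + 5 / (`|x ord0 i|%N%:R * t))).
  move=> xi0; apply: card_near_hyperplane => //.
  apply: le_trans Qe; rewrite ler_wpM2r ?(ltW h0)// ler_nat mxE.
  have := ltn_ord (w i); lia.
have Nle w : box_vec w != 0 ->
    #|N w|%:R <= D%:R ^+ n * (6 * e + (w \in small)%:R * (3 * e * (1 + 5 / t))).
  move=> w0; have [|] := boolP (w \in small); rewrite inE.
    move=> _; have [i xi0] : exists i, box_vec w ord0 i != 0.
      apply/existsP; apply: contraNT w0 => /existsPn H; apply/eqP/rowP => i.
      by rewrite [RHS]mxE; apply/eqP; rewrite -[_ == _]negbK H.
    apply: le_trans (NE w i xi0) _; rewrite ler_wpM2l// mul1r.
    have X1 : 1 <= `|box_vec w ord0 i|%N%:R :> R by rewrite ler1n absz_gt0.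
    have : 5 / (`|box_vec w ord0 i|%N%:R * t) <= 5 / t.
      have Xt : 0 < `|box_vec w ord0 i|%N%:R * t := mulr_gt0 (lt_le_trans ltr01 X1) t0.
      by rewrite ler_wpM2l// lef_pV2// ler_peMl// ltW.
    move=> /(ler_wpM2l e0); lra.
  rewrite negb_forall => /existsP[i]; rewrite -ltNge add0r mul1r mul0r addr0 => Ki.
  have Xi : K%:R < `|box_vec w ord0 i|%N%:R :> R.
    by rewrite natr_absz intr_norm mxE intrB.
  have K5 : 5 / t < K%:R by have /andP[] := truncn_itv t5.
  have Kp : 0 < K%:R :> R by rewrite ltr0n.
  have xi0 : box_vec w ord0 i != 0.
    by rewrite -absz_gt0 -(ltr0n R); exact: lt_trans Xi.
  apply: le_trans (NE w i xi0) _; rewrite ler_wpM2l//.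
  have : 5 / (`|box_vec w ord0 i|%N%:R * t) <= 1.
    have Xt : 0 < `|box_vec w ord0 i|%N%:R * t := mulr_gt0 (lt_trans Kp Xi) t0.
    by rewrite ler_pdivrMr// mul1r -ler_pdivrMr// ltW// (lt_trans K5).
  move=> /(ler_wpM2l e0); lra.
have cs : #|small|%:R <= (2 * K%:R + 1) ^+ n :> R.
  have := @card_box R _ (2 * Q).+1 1 (fun=> 0) (fun=> Q%:R) (fun=> K%:R) ltr01
    (fun _ : 'I_n => ler0n _ _).
  by rewrite divr1 prodr_const card_ord.
apply: (@le_trans _ _ (\sum_(w | box_vec w != 0) #|N w|%:R)).
  rewrite -natr_sum ler_nat; apply: card_cover_sum => a.
  rewrite !inE => -[x x0 [xQ nx]].
  have wP i : (`|(x ord0 i + Q%:Z)%R| < (2 * Q).+1)%N by have := xQ i; lia.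
  have xE : box_vec [ffun i => Ordinal (wP i)] = x.
    apply/rowP => i; rewrite mxE ffunE; exact: absz_shift (xQ i).
  by exists [ffun i => Ordinal (wP i)]; rewrite /N /= xE//; apply/asboolP.
apply: le_trans (ler_sum _ (fun w w0 => Nle w w0)) _.
rewrite -mulr_sumr ler_wpM2l// big_mkcond /=.
apply: (@le_trans _ _ (\sum_(w : {ffun 'I_n -> 'I_(2 * Q).+1})
    (6 * e + (w \in small)%:R * (3 * e * (1 + 5 / t))))).
  apply: ler_sum => w _; case: ifP => // _.
  by rewrite addr_ge0// ?mulr_ge0// addr_ge0.
rewrite big_split /= sumr_const card_ffun !card_ord -mulr_suml -natr_sum.
rewrite -[leLHS]/(_ + _) lerD//.
  by rewrite -[leLHS]mulr_natr natrX (_ : (2 * Q).+1%:R = 2 * Q%:R + 1)// -natrM natr1.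
rewrite ler_wpM2r//; first by rewrite ?mulr_ge0// addr_ge0.
apply: le_trans cs; rewrite ler_nat -sum1_card [leqRHS]big_mkcond /=.
by apply: leq_sum => w _; case: ifP.
Qed.

Lemma dot_first (R : realType) (m : nat) (a : 'I_m.+1 -> R) (x : 'rV[int]_m.+1)
    (z : R) :
  dot (set_first a z) x = dot a x + (z - a ord0) * (x ord0 ord0)%:~R.
Proof.
rewrite /dot (bigD1 ord0)//= [in RHS](bigD1 ord0)//= /set_first eqxx.
rewrite (eq_bigr (fun i => a i * (x ord0 i)%:~R)); last first.
  by move=> i /negbTE ->.
by ring.
Qed.

(** The Dirichlet vector now has first coordinate larger than [Q]; solving its equation for the
    first coordinate of the point divides the error by more than [Q]. *)
Lemma nonexceptional_resonant (R : realType) (m Q B : nat) (a : 'I_m.+1 -> R) :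
  (0 < Q)%N -> (0 < B)%N ->
  ~ exceptional Q ((B * Q ^ m.+1)%N%:R^-1) a ->
  exists z, resonant Q (B * Q) a z /\ `|z - a ord0| <= (B * Q ^ m.+2)%N%:R^-1.
Proof.
move=> Q0 B0 nex; have [x [x0 x1 x2 nx]] := dirichlet a Q0 B0.
have Qx : (Q < `|x ord0 ord0|)%N.
  rewrite ltnNge; apply/negP => xQ; apply: nex; exists x => //; split => // i.
  by have [->|] := eqVneq i ord0; [|exact: x2].
case: (nx) => p; set e := _^-1 => Hp.
have x00 : (x ord0 ord0)%:~R != 0 :> R.
  by rewrite intr_eq0 -absz_gt0; exact: leq_ltn_trans Qx.
exists (a ord0 + (p%:~R - dot a x) / (x ord0 ord0)%:~R); split.
  exists x, p; split => //; rewrite dot_first; field; exact: x00.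
rewrite addrAC subrr add0r normrM normfV distrC.
rewrite expnSr mulnA natrM invfM -/e.
apply: ler_pM => //.
rewrite -intr_norm -natr_absz lef_pV2 ?posrE ?ltr0n ?ler_nat ?(ltnW Qx)//.
exact: leq_ltn_trans Qx.
Qed.

(** Keeping to the middle half of each line ensures later that the widened hyperplanes stay inside
    the grid. *)
Lemma card_outer (R : realType) (m D : nat) : (0 < D)%N ->
  #|[pred a : {ffun 'I_m.+1 -> 'I_(4 * D)} | ~~ (D <= a ord0 < 3 * D)%N]|%:R
  <= (4 * D)%N%:R ^+ m.+1 / 2 :> R.
Proof.
move=> D0; set P := [pred a | _].
have D1 : 1 <= D%:R :> R by rewrite ler1n.
have DE : (4 * D)%N%:R = 4 * D%:R :> R by rewrite natrM.
have H : forall a, #|[pred v | P (upd a ord0 v)]|%:R <= 2 * D%:R :> R.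
  move=> a.
  have : (#|[pred v | P (upd a ord0 v)]| <=
    #|[pred v : 'I_(4 * D) | (v < D)%N]| + #|[pred v : 'I_(4 * D) | (3 * D <= v)%N]|)%N.
    by apply: card_cover => v; rewrite /= updE negb_and -ltnNge -leqNgt.
  rewrite -(ler_nat R) natrD => /le_trans; apply.
  have w1 : #|[pred v : 'I_(4 * D) | (v < D)%N]|%:R <= (D%:R - 1) + 1 :> R.
    apply: card_window; first by lra.
    move=> i j /= _; rewrite -(ler_nat R) -natr1.
    have : 0 <= i%:R :> R by []. lra.
  have w2 : #|[pred v : 'I_(4 * D) | (3 * D <= v)%N]|%:R <= (D%:R - 1) + 1 :> R.
    apply: card_window; first by lra.
    move=> i j /=; rewrite -(ler_nat R) natrM => i1 _.
    have := ltn_ord j; rewrite -(ler_nat R) -natr1 DE; lra.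
  lra.
have := card_fiber H; rewrite card_ffun !card_ord natrX DE => {}H.
rewrite -(ler_pM2l (_ : 0 < 4 * D%:R)); last by lra.
apply: le_trans H _; lra.
Qed.

(* A grid point is lost in two ways: it is not in the middle half of its fibre
   (at most 1/2 of the grid), or the vector of Dirichlet's theorem has first
   coordinate at most [B ^ k] (at most 1/8 + 1/8, by the choice of [B] for the
   large vectors and of [k0] for the small ones). *)
Lemma ubiquity (R : realType) (m B : nat) (t : R) :
  0 < t -> (48 * 3 ^ m.+1 <= B)%N ->
  exists k0, forall k D (o : 'I_m.+1 -> R) (h : R), (k0 <= k)%N -> (0 < D)%N -> 0 < h ->
    h * (4 * D)%N%:R = t ->
    (B ^ k)%N%:R * h <= (B * (B ^ k) ^ m.+1)%N%:R^-1 ->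
  (4 * D)%N%:R ^+ m.+1 / 4 <=
  #|[pred a : {ffun 'I_m.+1 -> 'I_(4 * D)} | (D <= a ord0 < 3 * D)%N &&
     `[< exists z, resonant (B ^ k) (B ^ k.+1) (gridpt o h a) z /\
          `|z - gridpt o h a ord0| <= (B * (B ^ k) ^ m.+2)%N%:R^-1 >] ]|%:R :> R.
Proof.
move=> t0 Bge.
have B1 : (1 < B)%N.
  by apply: leq_trans Bge; rewrite -[2%N]muln1 leq_mul// expn_gt0.
have B0 : (0 < B)%N by apply: ltn_trans B1.
(* [K * e] is the share of the small vectors. As [e <= 1 / k], a threshold above [8 * K] makes it at
   most 1/8. *)
pose K : R := (2 * (Num.trunc (5 / t)).+1%:R + 1) ^+ m.+1 * (3 * (1 + 5 / t)).
have K0 : 0 <= K.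
  by rewrite mulr_ge0 ?exprn_ge0 ?mulr_ge0// addr_ge0// ?divr_ge0// ltW.
exists (Num.trunc (8 * K)).+1 => k D o h k0k D0 h0 hD hk.
set Q := (B ^ k)%N; set e : R := (B * Q ^ m.+1)%N%:R^-1.
have Q0 : (0 < Q)%N by rewrite expn_gt0 B0.
have kQ : (k < Q)%N by rewrite ltn_expl.
have Q1 : 1 <= Q%:R :> R by rewrite ler1n.
have e1 : e <= 1.
  by rewrite invf_le1 ?ltr0n ?ler1n muln_gt0 B0 expn_gt0 Q0.
have e0 : 0 < e by rewrite invr_gt0 ltr0n muln_gt0 B0 expn_gt0 Q0.
have D4 : (0 < 4 * D)%N by rewrite muln_gt0.
have := @card_exceptional R m.+1 (4 * D) Q o h e D4 h0 hk e1.
rewrite hD; set X := #|_|%:R => HX.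
set G := [pred a | _ && _].
have cov : (#|{ffun 'I_m.+1 -> 'I_(4 * D)}| <=
  (#|[pred a : {ffun 'I_m.+1 -> 'I_(4 * D)} | ~~ (D <= a ord0 < 3 * D)%N]| +
   #|[pred a : {ffun 'I_m.+1 -> 'I_(4 * D)} | `[< exceptional Q e (gridpt o h a) >] ]|)
   + #|G|)%N.
  apply: leq_trans (card_cover (A := predU _ _) (B := G) _) _ => [a _|]; last first.
    by rewrite leq_add2r; apply: card_cover => a; exact.
  rewrite /G /=; case: (D <= a ord0 < 3 * D)%N => //=.
  have [ex|nex] := pselect (exceptional Q e (gridpt o h a)).
    by rewrite asboolT.
  apply/orP; right; apply/asboolP; rewrite expnS.
  exact: nonexceptional_resonant.
move: cov; rewrite -(ler_nat R) card_ffun !card_ord natrX.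
rewrite (natrD _ (_ + _)%N) (natrD _ #|_|) -/X.
have := card_outer R m D0.
set N := _ ^+ m.+1; set O := #|_|%:R => HO.
suff : X <= N / 4 by lra.
apply: le_trans HX _; rewrite ler_wpM2l//.
have t1 : 6 * e * (2 * Q%:R + 1) ^+ m.+1 <= 8^-1.
  have q3 : (2 * Q%:R + 1) ^+ m.+1 <= 3 ^+ m.+1 * Q%:R ^+ m.+1 :> R.
    rewrite -exprMn lerXn2r// ?nnegrE; lra.
  have QQ : 0 < Q%:R ^+ m.+1 :> R by rewrite exprn_gt0// ltr0n.
  have eE : e * Q%:R ^+ m.+1 = B%:R^-1.
    rewrite /e natrM natrX invfM -mulrA mulVf ?mulr1// gt_eqF//.
  apply: (@le_trans _ _ (6 * e * (3 ^+ m.+1 * Q%:R ^+ m.+1))).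
    by rewrite ler_wpM2l// mulr_ge0// ltW.
  have -> : 6 * e * (3 ^+ m.+1 * Q%:R ^+ m.+1) = 6 * 3 ^+ m.+1 / B%:R by rewrite -eE; ring.
  rewrite ler_pdivrMr ?ltr0n//; move: Bge; rewrite -(ler_nat R) natrM natrX; lra.
suff t2 : (2 * (Num.trunc (5 / t)).+1%:R + 1) ^+ m.+1 * (3 * e * (1 + 5 / t)) <= 8^-1 by lra.
have -> : (2 * (Num.trunc (5 / t)).+1%:R + 1) ^+ m.+1 * (3 * e * (1 + 5 / t)) = K * e.
  by rewrite /K; ring.
have eQ : e <= k%:R^-1.
  have BQ0 : (0 < B * Q ^ m.+1)%N by rewrite muln_gt0 B0 expn_gt0 Q0.
  rewrite lef_pV2 ?posrE ?ltr0n// ?(leq_trans _ k0k)//.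
  rewrite ler_nat (leq_trans (ltnW kQ))//.
  by rewrite (leq_trans _ (leq_pmull _ B0))// expnS leq_pmulr// expn_gt0 Q0.
have kR : (0:R) < k%:R by rewrite ltr0n (leq_trans _ k0k).
apply: (@le_trans _ _ (K * k%:R^-1)); first by rewrite ler_wpM2l.
rewrite ler_pdivrMr//.
have K8 : 0 <= 8 * K by rewrite mulr_ge0.
have /andP[_] := truncn_itv K8.
move: k0k; rewrite -(ler_nat R); lra.
Qed.

(** * Second moment estimate for the covered grid points *)

Lemma sum_half_le2 (R : realType) (l k0 k1 : nat) :
  \sum_(k0 <= k < k1 | (k <= l)%N) 2 ^- (l - k) <= 2 :> R.
Proof.
apply: (@le_trans _ _ (\sum_(0 <= k < k1 | (k <= l)%N) 2 ^- (l - k))).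
  have [k01|/ltnW k10] := leqP k0 k1.
    rewrite [leRHS](big_cat_nat (n := k0))//= lerDr; apply: sumr_ge0 => k _.
    by rewrite invr_ge0 exprn_ge0.
  by rewrite big_geq// sumr_ge0// => k _; rewrite invr_ge0 exprn_ge0.
have e k : (k <= l)%N -> 2 ^- (l - k) = 2 ^- l * 2 ^+ k :> R.
  by move=> kl; rewrite expfB_cond ?pnatr_eq0//= invfM invrK mulrC.
rewrite (eq_bigr _ e) -mulr_sumr ler_pdivrMl ?exprn_gt0// -exprSr.
suff : \sum_(0 <= i < k1 | (i <= l)%N) 2 ^+ i <= 2 ^+ (minn k1 l.+1) :> R.
  by move=> /le_trans; apply; rewrite ler_eXn2l ?ltr1n// geq_minr.
elim: k1 => [|k1 IH]; first by rewrite big_nil exprn_ge0.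
rewrite big_mkcond big_nat_recr//= -big_mkcond; have [k1l|lk1] := leqP k1 l.
  move: IH; rewrite (minn_idPl _) 1?ltnW// (minn_idPl _)//.
  by rewrite exprS; lra.
rewrite addr0; apply: le_trans IH _.
by rewrite ler_eXn2l ?ltr1n// !(minn_idPr _)// ltnW.
Qed.

Section SecondMoment.
Variables (R : realType) (I : finType) (i0 : I) (D : nat) (o : I -> R) (h : R).
Variables (k0 k1 : nat) (s delta : nat -> R).
Variables (G : nat -> pred {ffun I -> 'I_D}) (z : nat -> {ffun I -> 'I_D} -> R).

Local Notation ran k := (k0 <= k < k1)%N.

Hypothesis h0 : 0 < h.
Hypothesis hs : forall k, ran k -> 2 * h <= s k.
Hypothesis hdelta : forall k, ran k -> h <= delta k.
Hypothesis sle : forall k l, ran k -> ran l -> (k <= l)%N -> s l <= s k.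
Hypothesis deltale : forall k l, ran k -> ran l -> (k <= l)%N ->
  delta l <= delta k * 2 ^- (l - k).
Hypothesis zG : forall k a, ran k -> G k a ->
  [/\ `|z k a - gridpt o h a i0| <= delta k, o i0 + s k <= z k a
    & z k a < o i0 + h * D%:R].
Hypothesis Gge : forall k, ran k -> #|{ffun I -> 'I_D}|%:R / 4 <= #|G k|%:R :> R.
Hypothesis A1 : 1 <= \sum_(k0 <= k < k1) s k / delta k.

Let c := o i0.
Let near_z k a (v : 'I_D) : R := (G k a && (`|c + h * v%:R - z k a| <= s k))%:R.
(** This counts witnesses rather than hyperplanes: a hyperplane of level [k] may be counted about
    [delta k / h] times, which the weights [h / delta k] in [second_moment] compensate. *)
Let S_ k (b : {ffun I -> 'I_D}) : R := \sum_v near_z k (upd b i0 v) (b i0).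
Let N : R := #|{ffun I -> 'I_D}|%:R.

Let s0 k : ran k -> 0 < s k.
Proof. by move=> /hs H; have := h0; lra. Qed.
Let delta0 k : ran k -> 0 < delta k.
Proof. by move=> /hdelta H; have := h0; lra. Qed.

Let card_sum (T : finType) (P : pred T) : #|P|%:R = \sum_v (P v)%:R :> R.
Proof.
rewrite -sum1_card natr_sum big_mkcond; apply: eq_bigr => v _.
by rewrite unfold_in; case: (P v).
Qed.

(** After [sum_upd] has exchanged witness and covered point, each of the at least [N / 4] witnesses
    contributes the [s k / (2 * h)] grid points given by [card_near_ge]. *)
Lemma first_moment k : ran k -> N * (s k / (8 * h)) <= \sum_b S_ k b.
Proof.
move=> rk; rewrite /S_ (sum_upd i0 (fun a v => near_z k a v)).
apply: (@le_trans _ _ (\sum_a (G k a)%:R * (s k / (2 * h)))).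
  rewrite -mulr_suml -card_sum; have := Gge rk; rewrite -/N => Gk.
  have -> : N * (s k / (8 * h)) = (N / 4) * (s k / (2 * h)) by field; rewrite gt_eqF.
  by rewrite ler_wpM2r// divr_ge0 ?ltW ?s0// mulr_gt0.
apply: ler_sum => a _; rewrite /near_z; case: (boolP (G k a)) => Ga; last first.
  by rewrite mul0r big1.
have [_ z1 z2] := zG rk Ga; rewrite mul1r.
by have := card_near_ge h0 (hs rk) z1 z2; rewrite card_sum.
Qed.

(** Fix the witness [a] of level [k]. A witness [v'] of level [l] for the same covered point lies
    within [s k + s l + delta l] of [z k a], which bounds the choices of [v']; each of these leaves
    at most [3 * s l / h] covered points. No independence of the levels is involved. *)
Lemma cross_moment k l : ran k -> ran l -> (k <= l)%N ->
  \sum_b S_ k b * S_ l b <=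
  N * ((4 * s k + 3 * delta l) / h * (3 * s l / h)).
Proof.
move=> rk rl kl.
pose F a v := near_z k a v * \sum_v' near_z l (upd a i0 v') v.
have -> : \sum_b S_ k b * S_ l b = \sum_b \sum_v F (upd b i0 v) (b i0).
  apply: eq_bigr => b _; rewrite /F /S_ mulr_suml; apply: eq_bigr => v _.
  by congr (_ * _); apply: eq_bigr => v' _; rewrite upd_upd.
rewrite sum_upd.
have sk0 := s0 rk; have sl0 := s0 rl; have dl0 := delta0 rl.
have slk := sle rk rl kl.
apply: (@le_trans _ _ (\sum_(a : {ffun I -> 'I_D})
    ((4 * s k + 3 * delta l) / h * (3 * s l / h)))); last first.
  by rewrite sumr_const -[leLHS]mulr_natl.
apply: ler_sum => a _; rewrite /F.
have C0 : 0 <= 3 * s l / h by rewrite divr_ge0 ?mulr_ge0// ltW.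
pose P : pred 'I_D := [pred v' : 'I_D | `|c + h * v'%:R - z k a| <= 2 * s k + delta l].
have PE : #|P|%:R <= (4 * s k + 3 * delta l) / h.
  apply: le_trans (card_near_le D c (z k a) h0 (_ : 0 <= 2 * s k + delta l)) _; first by lra.
  have hl := hdelta rl.
  by rewrite -(ler_pM2r h0) mulrDl !divfK ?gt_eqF//; lra.
apply: (@le_trans _ _ (#|P|%:R * (3 * s l / h))); last by rewrite ler_wpM2r.
rewrite card_sum mulr_suml.
under eq_bigr do rewrite mulr_sumr.
rewrite exchange_big /=; apply: ler_sum => v' _.
have [Pv|Pv] := boolP (P v'); last first.
  rewrite mul0r big1// => v _; apply/eqP; rewrite -natrM pnatr_eq0 muln_eq0 !eqb0 -negb_and.
  apply: contra Pv => /andP[/andP[_ zk] /andP[Gl zl]].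
  have [] := zG rl Gl; rewrite /gridpt updE -/c => zv _ _.
  move: zk zl zv; rewrite /P /= !ler_norml => /andP[? ?] /andP[? ?] /andP[? ?].
  by apply/andP; split; lra.
rewrite mul1r; have [Gl|Gl] := boolP (G l (upd a i0 v')); last first.
  by rewrite big1// => v _; rewrite /near_z (negbTE Gl) mulr0.
apply: (@le_trans _ _ (\sum_v near_z l (upd a i0 v') v)).
  apply: ler_sum => v _; rewrite -natrM ler_nat; by case: (_ && _); rewrite ?mul1n.
rewrite /near_z Gl /=.
have := card_near_le D c (z l (upd a i0 v')) h0 (ltW sl0); rewrite card_sum => /le_trans; apply.
have hl := hs rl.
by rewrite -(ler_pM2r h0) mulrDl !divfK ?gt_eqF//; lra.
Qed.

(** With weights, the first moment is at least [N * A / 8]. The geometric decay of [delta] bounds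
    the second by [N * (12 * A ^+ 2 + 36 * A)], at most [48 * N * A ^+ 2] because [A >= 1]. Then
    [paley_zygmund] gives [3072 = 64 * 48]. *)
Lemma second_moment :
  N / 3072 <= #|[pred b : {ffun I -> 'I_D} | [exists k : 'I_k1, (k0 <= k)%N &&
    [exists v, G k (upd b i0 v) &&
       (`|gridpt o h b i0 - z k (upd b i0 v)| <= s k)]]]|%:R.
Proof.
pose al k := s k / delta k; pose A := \sum_(k0 <= k < k1) s k / delta k.
pose S b := \sum_(k0 <= k < k1) h / delta k * S_ k b.
set X := #|_|%:R.
have N0 : 0 <= N by [].
have al0 k : ran k -> 0 < al k by move=> rk; rewrite divr_gt0 ?s0 ?delta0.
have M1 : N * (A / 8) <= \sum_b S b.
  rewrite exchange_big /= /A mulr_suml mulr_sumr [leLHS]big_nat [leRHS]big_nat.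
  apply: ler_sum => k rk; rewrite -mulr_sumr.
  have -> : N * (s k / delta k / 8) = h / delta k * (N * (s k / (8 * h))).
    by field; rewrite !gt_eqF// delta0.
  by rewrite ler_pM2l ?first_moment// divr_gt0// delta0.
have Mkl k l : ran k -> ran l -> (k <= l)%N ->
    \sum_b (h / delta k * S_ k b) * (h / delta l * S_ l b)
    <= N * (12 * (al k * al l) + 9 * (al l * 2 ^- (l - k))).
  move=> rk rl kl.
  have dk0 := delta0 rk; have dl0 := delta0 rl.
  under eq_bigr do rewrite mulrACA.
  rewrite -mulr_sumr.
  apply: (@le_trans _ _ (h / delta k * (h / delta l) *
     (N * ((4 * s k + 3 * delta l) / h * (3 * s l / h))))).
    by rewrite ler_pM2l ?cross_moment// mulr_gt0// divr_gt0.
  rewrite [leLHS](_ : _ = N * (12 * (al k * al l) + 9 * (al l * (delta l / delta k))));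
    last by rewrite /al; field; rewrite !gt_eqF.
  rewrite ler_wpM2l// lerD2l ler_pM2l// ler_pM2l ?al0//.
  by rewrite ler_pdivrMr// mulrC deltale.
have M2 : \sum_b S b ^+ 2 <= N * (48 * A ^+ 2).
  have -> : \sum_b S b ^+ 2 = \sum_(k0 <= k < k1) \sum_(k0 <= l < k1)
      \sum_b (h / delta k * S_ k b) * (h / delta l * S_ l b).
    under [RHS]eq_bigr do rewrite exchange_big.
    rewrite [RHS]exchange_big; apply: eq_bigr => b _ /=.
    rewrite expr2 /S mulr_suml; apply: eq_bigr => k _; by rewrite mulr_sumr.
  (* [U] is a bound symmetric in [k] and [l], so that the double sum need not be split at the
     diagonal. *)
  pose U k l : R := 12 * (al k * al l) +
    9 * ((k <= l)%N%:R * (al l * 2 ^- (l - k)) + (l <= k)%N%:R * (al k * 2 ^- (k - l))).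
  apply: (@le_trans _ _ (\sum_(k0 <= k < k1) \sum_(k0 <= l < k1) N * U k l)).
    rewrite [leLHS]big_nat [leRHS]big_nat; apply: ler_sum => k rk.
    rewrite [leLHS]big_nat [leRHS]big_nat; apply: ler_sum => l rl.
    have pos p q : ran q -> 0 <= (p <= q)%N%:R * (al q * 2 ^- (q - p)) :> R.
      by move=> rq; rewrite mulr_ge0// mulr_ge0 ?ltW ?al0// invr_gt0 exprn_gt0.
    have [kl|lk] := leqP k l.
      apply: le_trans (Mkl _ _ rk rl kl) _; rewrite ler_wpM2l// /U kl mul1r.
      have := pos l k rk; lra.
    under eq_bigr do rewrite mulrC.
    apply: le_trans (Mkl _ _ rl rk (ltnW lk)) _; rewrite ler_wpM2l// /U (ltnW lk) [X in _ + 9 * (_ + X)]mul1r.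
    have := pos k l rl; lra.
  under eq_bigr do rewrite -mulr_sumr.
  rewrite -mulr_sumr ler_wpM2l// /U.
  under eq_bigr do rewrite big_split /= -!mulr_sumr.
  rewrite big_split /= -!mulr_sumr -mulr_suml.
  have half : \sum_(k0 <= k < k1) \sum_(k0 <= l < k1) (l <= k)%N%:R * (al k * 2 ^- (k - l)) <= 2 * A.
    rewrite [leLHS]big_nat /A mulr_sumr [leRHS]big_nat; apply: ler_sum => k rk.
    under eq_bigr do rewrite mulrCA.
    rewrite -mulr_sumr mulrC ler_pM2r ?al0//.
    apply: le_trans (sum_half_le2 R k k0 k1); rewrite [leRHS]big_mkcond.
    by apply: ler_sum => l _; case: ifP; rewrite ?mul1r ?mul0r.
  under [X in _ + 9 * X]eq_bigr do rewrite big_split /=.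
  rewrite big_split /= [X in _ + 9 * (X + _)]exchange_big /=.
  move: half; set Y := \sum_(_ <= _ < _) \sum_(_ <= _ < _) _ => half.
  rewrite -/A; have : 1 <= A := A1.
  nra.
have sub : #|[pred b | S b != 0]|%:R <= X.
  rewrite ler_nat; apply: subset_leq_card; apply/fintype.subsetP => b; rewrite !inE.
  apply: contraNT; rewrite negb_exists => /forallP H; rewrite /S big_nat big1// => k rk.
  have k1k : (k < k1)%N by case/andP: rk.
  have := H (Ordinal k1k); rewrite /= (proj1 (andP rk)) /= negb_exists => /forallP Hk.
  rewrite /S_ big1 ?mulr0// => v _; apply/eqP; rewrite pnatr_eq0 eqb0.
  exact: Hk.
have := paley_zygmund S.
have A0 : 1 <= A := A1.
have [->|Npos] := eqVneq N 0; first by rewrite mul0r.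
have {Npos}N1 : 0 < N by rewrite lt_neqAle eq_sym Npos.
set T1 := \sum_b S b in M1 *; set T2 := \sum_b S b ^+ 2 in M2 *.
set W := #|_|%:R in sub * => PZ.
have W0 : 0 <= W by [].
have H1 : (N * (A / 8)) ^+ 2 <= W * (N * (48 * A ^+ 2)).
  apply: le_trans (le_trans PZ _).
    by rewrite lerXn2r// nnegrE; [rewrite mulr_ge0// divr_ge0//; lra | apply: le_trans M1; rewrite mulr_ge0// divr_ge0//; lra].
  by rewrite ler_wpM2l.
apply: le_trans sub.
have NA : 0 < N * (48 * A ^+ 2) by rewrite mulr_gt0// mulr_gt0// exprn_gt0//; lra.
rewrite -(ler_pM2r NA); apply: le_trans H1.
by rewrite le_eqVlt; apply/orP; left; apply/eqP; field.
Qed.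

End SecondMoment.

(** * The inductive step *)

(** Greedy selection: take an element of largest weight, discard everything in conflict with it, and
    repeat. *)
Lemma finite_vitali (R : realType) (T : finType) (c : rel T) (w : T -> R)
    (P : pred T) :
  reflexive c -> symmetric c ->
  exists S : pred T, [/\ forall x, S x -> P x,
    forall x y, S x -> S y -> x != y -> ~~ c x y &
    forall x, P x -> exists y, [/\ S y, c x y & w x <= w y]].
Proof.
move=> crefl csym; have [n] := ubnP #|P|; elim: n P => // n IH P.
rewrite ltnS => Pn.
case: (pickP P) => [x0 Px0|P0]; last first.
  by exists pred0; split => // x; rewrite P0.
have [x Px xmax] := arg_maxP w Px0.
pose P' := [pred y | P y & ~~ c y x].
have ltP : (#|P'| < n)%N.
  apply: leq_trans Pn; apply: proper_card; apply/properP; split.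
    by apply/fintype.subsetP => y; rewrite !inE => /andP[].
  by exists x => //; rewrite !inE crefl andbF.
have [S [SP' Spair Scov]] := IH P' ltP.
exists [pred y | (y == x) || S y]; split => [y /orP[/eqP->//|/SP']|y y'|y Py].
- by move=> /andP[].
- move=> /orP[/eqP->|Sy] /orP[/eqP->|Sy'] yy'; first by rewrite eqxx in yy'.
  + by rewrite csym; have /andP[] := SP' _ Sy'.
  + by have /andP[] := SP' _ Sy.
  + exact: Spair.
- have [cyx|cyx] := boolP (c y x).
    by exists x; rewrite /= eqxx; split => //; exact: xmax.
  have [|y' [Sy' cy wy]] := Scov y; first by rewrite /= Py cyx.
  by exists y'; rewrite /= Sy' orbT.
Qed.

Lemma ler_distD_le (R : realDomainType) (a b c p q r : R) :
  `|a - b| <= p -> `|b - c| <= q -> p + q <= r -> `|a - c| <= r.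
Proof.
by move=> ab bc; apply: le_trans; apply: le_trans (ler_distD b a c) (lerD ab bc).
Qed.

Lemma finite_min (R : realType) (F : nat -> R) (K : nat) :
  (forall k, 0 < F k) -> exists2 X, 0 < X & forall k, (k < K)%N -> X <= F k.
Proof.
move=> F0; elim: K => [|K [X X0 XF]]; first by exists 1.
exists (Num.min X (F K)) => [|k]; first by rewrite lt_min X0 F0.
rewrite ltnS leq_eqVlt => /orP[/eqP->|/XF Xk]; first by rewrite ge_min lexx orbT.
by rewrite ge_min Xk.
Qed.

(** [11] and [9] are [2 * 5 + 1] and [2 * 4 + 1], the rounding term being absorbed by [h <= S] and
    [h <= r]. *)
Lemma card_prism (R : realType) (m D : nat) (o v : 'I_m.+1 -> R) (h S r : R) :
  0 < h -> h <= S -> h <= r ->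
  #|[pred b : {ffun 'I_m.+1 -> 'I_D} | [forall j,
     `|gridpt o h b j - v j| <= if j == ord0 then 5 * S else 4 * r]]|%:R
  <= 11 * 9 ^+ m * (S * r ^+ m) / h ^+ m.+1.
Proof.
move=> h0 hS hr.
have H := @card_box R _ D h o v (fun j => if j == ord0 then 5 * S else 4 * r) h0.
apply: le_trans (H _) _ => [j|]; first by case: ifP => _; lra.
rewrite big_ord_recl /=; under eq_bigr do rewrite /=.
rewrite prodr_const card_ord.
have -> : 11 * 9 ^+ m * (S * r ^+ m) / h ^+ m.+1 = (11 * (S / h)) * (9 * (r / h)) ^+ m.
  rewrite exprMn expr_div_n exprSr; field; by rewrite expf_neq0 gt_eqF.
have S1 : 1 <= S / h by rewrite ler_pdivlMr// mul1r.
have r1 : 1 <= r / h by rewrite ler_pdivlMr// mul1r.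
have e1 : 2 * (5 * S) / h + 1 <= 11 * (S / h).
  by rewrite -[2 * _ / h]mulrA -[5 * S / h]mulrA; lra.
have e2 : 2 * (4 * r) / h + 1 <= 9 * (r / h).
  by rewrite -[2 * _ / h]mulrA -[4 * r / h]mulrA; lra.
have z1 : 0 <= 2 * (5 * S) / h + 1.
  by rewrite -[2 * _ / h]mulrA -[5 * S / h]mulrA; lra.
have z2 : 0 <= 2 * (4 * r) / h + 1.
  by rewrite -[2 * _ / h]mulrA -[4 * r / h]mulrA; lra.
by apply: ler_pM => //; [exact: exprn_ge0 | rewrite lerXn2r// nnegrE; lra].
Qed.

Lemma sum_at_most_one (R : realType) (T : finType) (P : pred T) (C : R) :
  0 <= C -> (forall x y, P x -> P y -> x = y) -> \sum_(x | P x) C <= C.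
Proof.
move=> C0 P1; case: (pickP P) => [x Px|P0]; last by rewrite big_pred0.
by rewrite (big_pred1 x)// => y; apply/idP/eqP => [/P1|->//]; exact.
Qed.

(** Closed cubes of the sup norm, for which intersection is a condition on each coordinate of the
    centres. *)
Definition meets (R : realType) (n : nat) (u : nat -> 'I_n -> R) (e : nat -> R)
    (c : 'I_n -> R) (t : R) (i : nat) : bool :=
  [forall j, `|u i j - c j| <= e i + t].

Definition light (R : realType) (n : nat) (f : R -> R) (eps : R)
    (u : nat -> 'I_n -> R) (e : nat -> R) (c : 'I_n -> R) (t : R) : Prop :=
  forall N, \sum_(i < N | meets u e c t i) f (e i) <= eps * f t.

Lemma addn_leW4 a b c d k : (a + b + c + d <= k)%N ->
  [/\ a <= k, b <= k, c <= k & d <= k]%N.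
Proof. by split; lia. Qed.

Section Step.
Variables (R : realType) (m B : nat) (f : R -> R) (rho : nat -> R).
Hypothesis Bge : (48 * 3 ^ m.+1 <= B)%N.
Hypothesis fmono : forall r s : R, 0 <= r -> r <= s -> f r <= f s.
Hypothesis fpos : forall r : R, 0 < r -> 0 < f r.
Hypothesis gmono : forall r s : R, 0 < r -> r <= s -> f r / r ^+ m <= f s / s ^+ m.
Hypothesis qmono : forall r s : R, 0 < r -> r <= s ->
  f s / s ^+ m.+1 <= f r / r ^+ m.+1.
Hypothesis gto0 : forall e : R, 0 < e ->
  exists2 d : R, 0 < d & forall r : R, 0 < r -> r <= d -> f r / r ^+ m <= e.
Hypothesis rho0 : forall k, 0 < rho k.
Hypothesis rho_noninc : forall k l, (k <= l)%N -> rho l <= rho k.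
Hypothesis rho_to0 : forall e : R, 0 < e -> exists k, rho k <= e.

(** The distance within which [ubiquity] finds a hyperplane of level [k]; it plays the role of
    [delta] in the second moment estimate. *)
Definition level_gap (k : nat) : R := (B * (B ^ k) ^ m.+2)%N%:R^-1.

Hypothesis divergent : forall k0 (X : R), exists k1,
  X <= \sum_(k0 <= k < k1) f (rho k) / rho k ^+ m / level_gap k.

Variables (u : nat -> 'I_m.+1 -> R) (e : nat -> R).
Hypothesis e0 : forall i, 0 < e i.
Hypothesis summable : forall eta : R, 0 < eta ->
  exists I0, forall N, \sum_(I0 <= i < N) f (e i) <= eta.

(* Each of the two families of boxes that cover the bad grid points fills at
   most [11 * 9 ^+ m * eps] of the grid; with this [eps] that is [1 / (2 * 16 ^ 3)]
   each, and together less than the proportion [1 / 3072] of [second_moment]. *)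
Definition step_eps : R := (22 * 9 ^+ m * 16 ^+ 3)^-1.
Local Notation eps := step_eps.

Let eps0 : 0 < eps. Proof. by rewrite invr_gt0 !mulr_gt0 ?exprn_gt0. Qed.

Let eps1 : eps < 1.
Proof.
rewrite invf_lt1 ?mulr_gt0 ?exprn_gt0//.
have : 1 <= 9 ^+ m :> R by rewrite exprn_ege1// ler1n.
lra.
Qed.

Let B1 : (1 < B)%N.
Proof. by apply: leq_trans Bge; rewrite -[2%N]muln1 leq_mul// expn_gt0. Qed.

Let B0 : (0 < B)%N. Proof. exact: ltnW B1. Qed.

Lemma level_gap_gt0 k : 0 < level_gap k.
Proof. by rewrite invr_gt0 ltr0n muln_gt0 expn_gt0 expn_gt0 B0. Qed.

Lemma level_gap_le k l : (k <= l)%N -> level_gap l <= level_gap k * 2 ^- (l - k).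
Proof.
have L p : 0 < (B * (B ^ p) ^ m.+2)%N%:R :> R.
  by rewrite ltr0n muln_gt0 B0 expn_gt0 expn_gt0 B0.
move=> kl; rewrite /level_gap -invfM lef_pV2 ?posrE ?mulr_gt0 ?exprn_gt0//.
rewrite -natrX -natrM ler_nat -mulnA leq_mul2l -!expnM; apply/orP; right.
rewrite -{2}(subnKC kl) mulnDl expnD leq_mul2l; apply/orP; right.
apply: (@leq_trans (B ^ (l - k))); first by case: (l - k)%N => // p; rewrite leq_exp2r.
by rewrite leq_exp2l// leq_pmulr.
Qed.

Lemma level_gap_small (x : R) : 0 < x ->
  exists K, forall k, (K <= k)%N -> level_gap k <= x.
Proof.
move=> x0; exists (Num.trunc x^-1).+1 => k Kk.
have xv : 0 <= x^-1 by rewrite invr_ge0 ltW.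
have /andP[_ xK] := truncn_itv xv.
rewrite -[leRHS]invrK lef_pV2 ?posrE ?invr_gt0//; last first.
  by rewrite ltr0n muln_gt0 expn_gt0 expn_gt0 B0.
apply: ltW (lt_le_trans xK _); rewrite ler_nat (leq_trans Kk)//.
apply: leq_trans (ltnW (ltn_expl k B1)) _.
by rewrite (leq_trans _ (leq_pmull _ B0))// expnS leq_pmulr// expn_gt0 expn_gt0 B0.
Qed.

(** [rho K] is taken below the finitely many radii that precede a small tail, so the filter keeps
    only indices of that tail. *)
Lemma tail_small (eta : R) : 0 < eta ->
  exists K, forall N, \sum_(i < N | e i < rho K) f (e i) <= eta.
Proof.
move=> eta0; have [I0 HI] := summable eta0.
have [X X0 XI] := finite_min I0 e0.
have [K KX] := rho_to0 X0; exists K => N.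
rewrite -(big_mkord (fun i => e i < rho K) (fun i => f (e i))) big_mkcond /=.
have small i : (i < I0)%N -> (if e i < rho K then f (e i) else 0) = 0.
  by move=> iI; rewrite ltNge (le_trans KX)// XI.
have [NI|IN] := leqP N I0.
  rewrite big_nat big1 ?(ltW eta0)// => i /andP[_ iN].
  by rewrite small// (leq_trans iN).
rewrite (big_cat_nat (n := I0)) ?(ltnW IN)//= [X in X + _]big_nat big1 ?add0r.
  apply: le_trans (HI N); apply: ler_sum => i _; case: ifP => // _.
  exact: ltW (fpos (e0 i)).
by move=> i /andP[_ iI]; rewrite small.
Qed.

Lemma step (c : 'I_m.+1 -> R) (t : R) (K : nat) :
  0 < t -> light f eps u e c t ->
  exists c' k, [/\ (K <= k)%N, forall j, `|c' j - c j| + rho k <= t,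
    light f eps u e c' (rho k) &
    exists (x : 'rV[int]_m.+1) (p : int),
    [/\ (B ^ k < `|x ord0 ord0|)%N, (`|x ord0 ord0| <= B ^ k.+1)%N,
      forall j, j != ord0 -> (`|x ord0 j| <= B ^ k)%N & dot c' x = p%:~R]].
Proof.
move=> t0 ct.
(* [lam] is normalised so that [S t = t]. A prism of half-side [S r] in the first direction and [r]
   in the others has volume proportional to [f r], which turns sums of [f] into volumes. *)
set lam := t ^+ m.+1 / f t.
have ft0 := fpos t0.
have lam0 : 0 < lam by rewrite divr_gt0 ?exprn_gt0.
pose S r := lam * (f r / r ^+ m).
have S0 r : 0 < r -> 0 < S r by move=> r0; rewrite mulr_gt0// divr_gt0 ?exprn_gt0// fpos.
have Smono r r' : 0 < r -> r <= r' -> S r <= S r'.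
  by move=> r0 rr'; rewrite ler_pM2l// gmono.
have rS r : 0 < r -> r <= t -> r <= S r.
  move=> r0 rt; have := qmono r0 rt.
  rewrite ler_pdivrMr ?exprn_gt0// => H.
  have fr0 := fpos r0.
  have E : f r / r ^+ m.+1 * t ^+ m.+1 = S r / r * f t.
    rewrite /S /lam [r ^+ m.+1]exprSr; field.
    by rewrite !gt_eqF ?exprn_gt0.
  by move: H; rewrite E ler_pMl// ler_pdivlMr// mul1r.
have t8 : 0 < t / 8 by lra.
have t4 : 0 < t / 4 by lra.
have t8l : 0 < t / 8 / lam by rewrite divr_gt0.
(* From level [K1] on, widened hyperplanes found from the middle half stay inside the grid, and
   candidate cubes stay inside the cube of radius [t]. *)
have [K1 HK1] : exists K1, forall k, (K1 <= k)%N ->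
    [/\ S (rho k) <= t / 8, level_gap k <= t / 8 & rho k <= t / 4].
  have [d d0 Hd] := gto0 t8l.
  have [a Ha] := rho_to0 d0.
  have [b Hb] := level_gap_small t8.
  have [c' Hc] := rho_to0 t4.
  exists (a + b + c' + 0)%N => k /addn_leW4[ak bk ck _]; split.
  - rewrite /S mulrC -ler_pdivlMr//; apply: Hd => //.
    by apply: le_trans Ha; exact: rho_noninc.
  - exact: Hb.
  - by apply: le_trans Hc; exact: rho_noninc.
have [K2 HK2] := ubiquity t0 Bge.
(* One factor [eps] is lost because a heavy candidate of radius [r] is only known to carry mass
   [eps * f r]; the other has to remain at the end. *)
have eta0 : 0 < eps ^+ 2 * f t by rewrite mulr_gt0 ?exprn_gt0.
have [K3 HK3] := tail_small eta0.
pose k0 := (K + K1 + K2 + K3)%N.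
(* Finitely many levels make the ratios of width to gap add up to at least 1, as [second_moment]
   requires. *)
have [k1 Hk1] := divergent k0 lam^-1.
have A1 : 1 <= \sum_(k0 <= k < k1) S (rho k) / level_gap k.
  rewrite /S (eq_bigr (fun k => lam * (f (rho k) / rho k ^+ m / level_gap k))).
    by rewrite -mulr_sumr -ler_pdivrMl// mulr1.
  by move=> k _; rewrite [RHS]mulrA.
(* A mesh of at most [X] resolves the widths, gaps and radii of all the levels in use and meets the
   mesh condition of [ubiquity]. *)
have [X X0 HX] : exists2 X, 0 < X & forall k, (k < k1)%N ->
    [/\ 2 * X <= S (rho k), X <= level_gap k, X <= rho k &
        (B ^ k)%N%:R * X <= (B * (B ^ k) ^ m.+1)%N%:R^-1].
  pose F k := Num.min (Num.min (S (rho k) / 2) (level_gap k))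
    (Num.min (rho k) ((B * (B ^ k) ^ m.+1)%N%:R^-1 / (B ^ k)%N%:R)).
  have Bk k : 0 < (B ^ k)%N%:R :> R by rewrite ltr0n expn_gt0 B0.
  have [k|X X0 HX] := @finite_min R F k1.
    rewrite !lt_min divr_gt0 ?S0// level_gap_gt0 rho0 divr_gt0//.
    by rewrite invr_gt0 ltr0n muln_gt0 expn_gt0 expn_gt0 B0.
  exists X => // k kk; have := HX _ kk; rewrite !le_min => /andP[/andP[h1 h2] /andP[h3 h4]].
  split => //; first by lra.
  by rewrite mulrC -ler_pdivlMr.
pose D := (Num.trunc (t / (4 * X))).+1.
have D0 : (0 < D)%N by [].
pose h := t / (4 * D)%N%:R.
have DR : 0 < D%:R :> R by rewrite ltr0n.
have D4E : (4 * D)%N%:R = 4 * D%:R :> R by rewrite natrM.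
have h0 : 0 < h by rewrite divr_gt0// D4E mulr_gt0.
have hD : h * (4 * D)%N%:R = t by rewrite /h divfK// D4E gt_eqF// mulr_gt0.
have hX : h <= X.
  have tX : 0 <= t / (4 * X) by rewrite divr_ge0 ?mulr_ge0// ltW.
  have /andP[_] := truncn_itv tX; rewrite -/D ltr_pdivrMr ?mulr_gt0// => tD.
  by rewrite /h D4E ler_pdivrMr ?mulr_gt0//; lra.
(* The grid fills the concentric cube of half-side [t / 2], leaving room for the displacements and
   the radii. *)
pose o j := c j - t / 2.
pose good k (a : {ffun 'I_m.+1 -> 'I_(4 * D)}) z :=
  resonant (B ^ k) (B ^ k.+1) (gridpt o h a) z /\
  `|z - gridpt o h a ord0| <= level_gap k.
pose G k : pred {ffun 'I_m.+1 -> 'I_(4 * D)} :=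
  fun a => (D <= a ord0 < 3 * D)%N && `[< exists z, good k a z >].
have [zf Hzf] : exists zf : nat * {ffun 'I_m.+1 -> 'I_(4 * D)} -> R,
    forall ka, G ka.1 ka.2 -> good ka.1 ka.2 (zf ka).
  have Hka (ka : nat * {ffun 'I_m.+1 -> 'I_(4 * D)}) :
      exists z, G ka.1 ka.2 -> good ka.1 ka.2 z.
    have [[z gz]|nz] := pselect (exists z, good ka.1 ka.2 z); first by exists z.
    by exists 0 => /andP[_ /asboolP].
  by have [zf Hzf] := choice Hka; exists zf.
pose z k a := zf (k, a).
have rangeK k : (k0 <= k < k1)%N -> [/\ (K <= k)%N, (K1 <= k)%N, (K2 <= k)%N & (K3 <= k)%N].
  by case/andP => /addn_leW4.
have gridE a j : gridpt o h a j - c j = h * (a j)%:R - t / 2.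
  by rewrite /gridpt /o; ring.
have grid_le (a : {ffun 'I_m.+1 -> 'I_(4 * D)}) j : `|gridpt o h a j - c j| <= t / 2.
  rewrite gridE; have ha : 0 <= h * (a j)%:R by rewrite mulr_ge0// ltW.
  have ha' : h * (a j)%:R <= t by rewrite -hD ler_pM2l// ler_nat ltnW.
  by rewrite ler_norml; apply/andP; split; lra.
have hk k : (k0 <= k < k1)%N -> [/\ 2 * h <= S (rho k), h <= level_gap k, h <= rho k &
        (B ^ k)%N%:R * h <= (B * (B ^ k) ^ m.+1)%N%:R^-1].
  move=> /andP[_ kk]; have [h1 h2 h3 h4] := HX _ kk; split; [lra|lra|lra|].
  by apply: le_trans h4; rewrite ler_wpM2l.
have zP k a : (k0 <= k < k1)%N -> G k a ->
    [/\ `|z k a - gridpt o h a ord0| <= level_gap k,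
        o ord0 + S (rho k) <= z k a & z k a < o ord0 + h * (4 * D)%N%:R].
  move=> rk Ga; have [_ zg] := Hzf (k, a) Ga.
  have [_ kK1 _ _] := rangeK _ rk; have [s1 s2 s3] := HK1 _ kK1.
  have [/andP[a1 a2] _] := andP Ga.
  have ha1 : t / 4 <= h * (a ord0)%:R.
    have <- : h * D%:R = t / 4 by rewrite -hD D4E; field.
    by rewrite ler_pM2l// ler_nat.
  have ha2 : h * (a ord0)%:R <= 3 * (t / 4).
    have <- : h * (3 * D)%N%:R = 3 * (t / 4) by rewrite -hD D4E natrM; field.
    by rewrite ler_pM2l// ler_nat ltnW.
  have zg' : `|z k a - gridpt o h a ord0| <= level_gap k by [].
  split => //; move: zg'; rewrite /gridpt ler_norml => /andP[z1 z2]; first by lra.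
  rewrite hD; lra.
have SM : (4 * D)%N%:R ^+ m.+1 / 3072 <= #|[pred b : {ffun 'I_m.+1 -> 'I_(4 * D)} |
    [exists k : 'I_k1, (k0 <= k)%N && [exists v, G k (upd b ord0 v) &&
       (`|gridpt o h b ord0 - z k (upd b ord0 v)| <= S (rho k))]]]|%:R :> R.
  have -> : (4 * D)%N%:R ^+ m.+1 = #|{ffun 'I_m.+1 -> 'I_(4 * D)}|%:R :> R.
    by rewrite card_ffun !card_ord natrX.
  apply: (@second_moment R _ ord0 (4 * D) o h k0 k1 (S \o rho) level_gap G z h0) => //.
  - by move=> k /hk[].
  - by move=> k /hk[].
  - by move=> k l _ _ kl; apply: Smono => //; exact: rho_noninc.
  - by move=> k l _ _; exact: level_gap_le.
  - move=> k rk; have [_ _ kK2 _] := rangeK _ rk; have [_ _ _ h4] := hk _ rk.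
    by rewrite card_ffun !card_ord natrX; exact: HK2.
(* Candidate centres: grid points moved along the first axis onto their hyperplane. If the step
   fails, none of these cubes is light. *)
pose cq k a : 'I_m.+1 -> R := set_first (gridpt o h a) (z k a).
apply: contrapT => nex.
have cq_in k a j : (k0 <= k < k1)%N -> G k a -> `|cq k a j - c j| + rho k <= t.
  move=> rk Ga; have [_ kK1 _ _] := rangeK _ rk; have [s1 s2 s3] := HK1 _ kK1.
  have [z1 _ _] := zP _ _ rk Ga; have g1 := grid_le a j.
  rewrite -lerBrDr /cq /set_first; case: eqP => [j0|_].
    rewrite j0 in g1 *; apply: ler_distD_le z1 g1 _; lra.
  by apply: le_trans g1 _; lra.
have notlight k a : (k0 <= k < k1)%N -> G k a ->
    exists N, eps * f (rho k) < \sum_(i < N | meets u e (cq k a) (rho k) i) f (e i).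
  move=> rk Ga; apply: contrapT => nl; apply: nex; exists (cq k a), k; split.
  - by have [] := rangeK _ rk.
  - by move=> j; exact: cq_in.
  - by move=> N; rewrite leNgt; apply/negP => H; apply: nl; exists N.
  - have [[x [p [x1 x2 x3 x4]]] _] := Hzf (k, a) Ga.
    by exists x, p; split.
have [Nf HNf] : exists Nf : nat * {ffun 'I_m.+1 -> 'I_(4 * D)} -> nat,
    forall ka, (k0 <= ka.1 < k1)%N -> G ka.1 ka.2 -> eps * f (rho ka.1) <
      \sum_(i < Nf ka | meets u e (cq ka.1 ka.2) (rho ka.1) i) f (e i).
  have Hka (ka : nat * {ffun 'I_m.+1 -> 'I_(4 * D)}) :
      exists N, (k0 <= ka.1 < k1)%N -> G ka.1 ka.2 -> eps * f (rho ka.1) <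
      \sum_(i < N | meets u e (cq ka.1 ka.2) (rho ka.1) i) f (e i).
    have [[r g]|ng] := pselect ((k0 <= ka.1 < k1)%N /\ G ka.1 ka.2).
      by have [N] := notlight _ _ r g; exists N.
    by exists 0%N => r g; case: ng.
  by have [Nf HNf] := choice Hka; exists Nf.
pose T := ('I_k1 * {ffun 'I_m.+1 -> 'I_(4 * D)})%type.
(* There are finitely many candidates, so a single truncation shows all of them to be heavy. *)
pose N0 := \max_(x : T) Nf (x.1 : nat, x.2).
pose cT (x : T) := cq x.1 x.2.
pose rT (x : T) := rho x.1.
pose V : pred T := fun x => (k0 <= x.1)%N && G x.1 x.2.
have fe i : 0 <= f (e i) by exact: ltW (fpos (e0 i)).
have rV x : V x -> (k0 <= x.1 < k1)%N.
  by move=> /andP[r g]; rewrite r ltn_ord.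
have heavy x : V x ->
    eps * f (rT x) < \sum_(i < N0 | meets u e (cT x) (rT x) i) f (e i).
  move=> Vx; have [r g] := andP Vx.
  apply: lt_le_trans (HNf (x.1 : nat, x.2) (rV _ Vx) g) _.
  have le0 : (Nf (x.1 : nat, x.2) <= N0)%N by exact: leq_bigmax.
  rewrite (big_ord_widen_cond _ (fun i => meets u e (cT x) (rT x) i) (fun i => f (e i)) le0).
  rewrite [leLHS]big_mkcond [leRHS]big_mkcond /=; apply: ler_sum => i _.
  by case: (meets _ _ _ _ _) => //=; case: ifP.
(* A candidate meeting some cube [i] with [rT x <= e i] is charged to that cube; those in [P] owe
   their mass to smaller cubes only. *)
pose ty1 (x : T) := [exists i : 'I_N0, meets u e (cT x) (rT x) i && (rT x <= e i)].
pose P : pred T := fun x => V x && ~~ ty1 x.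
(* Two candidates meeting a common cube smaller than both are in conflict, so a small cube meets at
   most one selected candidate. *)
pose conf : rel T := fun x y => [forall j, `|cT x j - cT y j| <= 2 * (rT x + rT y)].
have rT0 x : 0 < rT x by exact: rho0.
have [Sel [SelP Selpair Selcov]] : exists S : pred T, [/\ forall x, S x -> P x,
    forall x y, S x -> S y -> x != y -> ~~ conf x y &
    forall x, P x -> exists y, [/\ S y, conf x y & rT x <= rT y]].
  apply: finite_vitali => [x|x y].
    apply/forallP => j; rewrite subrr normr0 mulr_ge0// addr_ge0//; exact: ltW.
  by apply: eq_forallb => j; rewrite distrC [rT x + _]addrC.
(* A covered point is within [S (rT x)] of [cT x] in the first direction and agrees with it in the
   others. Passing to a selected [y] with [rT x <= rT y] adds [2 * (rT x + rT y)], whence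
   [5 * S (rT y)] and [4 * rT y]. Charging to a cube [i] needs less. *)
pose Pr (v : 'I_m.+1 -> R) (r : R) : pred {ffun 'I_m.+1 -> 'I_(4 * D)} :=
  [pred b | [forall j, `|gridpt o h b j - v j| <= if j == ord0 then 5 * S r else 4 * r]].
pose W : R := 11 * 9 ^+ m * lam / h ^+ m.+1.
have W0 : 0 < W by rewrite divr_gt0 ?exprn_gt0// (mulr_gt0 _ lam0)// mulr_gt0 ?exprn_gt0.
have PrW v r : h <= r -> r <= t -> #|Pr v r|%:R <= W * f r.
  move=> hr rt; have r0 := lt_le_trans h0 hr.
  apply: le_trans (@card_prism _ m (4 * D) o v h (S r) r h0 (le_trans hr (rS _ r0 rt)) hr) _.
  rewrite /W /S le_eqVlt; apply/orP; left; apply/eqP; field.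
  by rewrite !expf_neq0// gt_eqF.
pose J (i : 'I_N0) := meets u e c t i && (h <= e i).
(* A larger cube would by itself exceed the mass that lightness allows. *)
have Jt i : J i -> e i <= t.
  move=> /andP[mi _]; rewrite leNgt; apply/negP => /ltW te.
  have : f (e i) <= eps * f t.
    apply: le_trans (ct N0); rewrite (bigD1 i)//= lerDl; apply: sumr_ge0 => ? _; exact: fe.
  have := fmono (ltW t0) te; have : eps * f t < f t by rewrite gtr_pMl.
  lra.
have rTt x : V x -> [/\ h <= rT x, rT x <= t & forall j, `|cT x j - c j| + rT x <= t].
  move=> Vx; have rk := rV _ Vx; have [_ _ h3 _] := hk _ rk; split => //.
    by have [_ kK1 _ _] := rangeK _ rk; have [_ _] := HK1 _ kK1; rewrite /rT; lra.
  by move=> j; apply: cq_in => //; have [] := andP Vx.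
have cover : (4 * D)%N%:R ^+ m.+1 / 3072 <=
    \sum_(i | J i) #|Pr (u i) (e i)|%:R + \sum_(x | Sel x) #|Pr (cT x) (rT x)|%:R :> R.
  apply: le_trans SM _; rewrite -!natr_sum -natrD ler_nat.
  pose JJ (y : 'I_N0 + T) := match y with inl i => J i | inr x => Sel x end.
  pose AA (y : 'I_N0 + T) := match y with inl i => Pr (u i) (e i) | inr x => Pr (cT x) (rT x) end.
  apply: leq_trans (card_cover_sum (J := JJ) (A := AA) _) _; last by rewrite big_sumType.
  move=> b /= /existsP[k /andP[kk /existsP[v /andP[Gv bz]]]].
  pose x : T := (k, upd b ord0 v).
  have Vx : V x by apply/andP.
  have [hx xt xin] := rTt _ Vx.
  have bx j : `|gridpt o h b j - cT x j| <= if j == ord0 then S (rT x) else 0.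
    rewrite /cT /cq /set_first /=; case: eqP => [->//|/eqP j0].
    by rewrite /gridpt updN// subrr normr0.
  have Sx : rT x <= S (rT x) by exact: rS.
  have [/existsP[i /andP[mi rei]]|nty] := boolP (ty1 x).
    have mJ : J i.
      apply/andP; split; last exact: le_trans rei.
      apply/forallP => j; move: (xin j) (forallP mi j).
      rewrite -lerBrDr => xj mj; apply: ler_distD_le mj xj _.
      by rewrite addrACA subrr addr0.
    exists (inl i) => //=; apply/forallP => j.
    have eS : e i <= S (e i) by apply: rS => //; exact: Jt.
    have SS : S (rT x) <= S (e i) by exact: Smono.
    have := forallP mi j; have := bx j.
    have := ler_normD (gridpt o h b j - cT x j) (cT x j - u i j); rewrite subrKA.
    rewrite [`|cT x j - u i j|]distrC; case: ifP => _; lra.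
  have [|y [Sy cxy wxy]] := Selcov x; first by apply/andP.
  exists (inr y) => //=; apply/forallP => j.
  have [hy yt _] := rTt _ (proj1 (andP (SelP _ Sy))).
  have Sy' : rT y <= S (rT y) by exact: rS.
  have SS : S (rT x) <= S (rT y) by exact: Smono.
  have := forallP cxy j; have := bx j.
  have := ler_normD (gridpt o h b j - cT x j) (cT x j - cT y j); rewrite subrKA.
  case: ifP => _; lra.
have sum1 : \sum_(i | J i) #|Pr (u i) (e i)|%:R <= W * (eps * f t).
  apply: (@le_trans _ _ (\sum_(i | J i) W * f (e i))).
    apply: ler_sum => i Ji; apply: PrW; last exact: Jt.
    by have [] := andP Ji.
  rewrite -mulr_sumr ler_pM2l//; apply: le_trans (ct N0).
  rewrite [leLHS]big_mkcond [leRHS]big_mkcond; apply: ler_sum => i _.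
  by rewrite /J; case: (meets _ _ _ _ _) => //=; case: ifP.
have sum2 : \sum_(x | Sel x) #|Pr (cT x) (rT x)|%:R <= W * (eps * f t).
  apply: (@le_trans _ _ (\sum_(x | Sel x) W * f (rT x))).
    apply: ler_sum => x Sx; have [hx xt _] := rTt _ (proj1 (andP (SelP _ Sx))).
    exact: PrW.
  rewrite -mulr_sumr ler_pM2l// -(ler_pM2l eps0).
  (* The cubes carried by selected candidates are smaller than [rho k0], hence in the tail fixed by
     [K3]. *)
  apply: (@le_trans _ _ (\sum_(i < N0 | e i < rho k0) f (e i))); last first.
    rewrite mulrA -expr2; apply: le_trans (HK3 N0).
    rewrite [leLHS]big_mkcond [leRHS]big_mkcond; apply: ler_sum => i _.
    case: ifP => [ei|_]; last by case: ifP.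
    by rewrite (lt_le_trans ei)// rho_noninc// /k0 leq_addl.
  rewrite mulr_sumr.
  apply: (@le_trans _ _ (\sum_(x | Sel x)
      \sum_(i < N0 | meets u e (cT x) (rT x) i && (e i < rT x)) f (e i))).
    apply: ler_sum => x Sx; have [Vx nty] := andP (SelP _ Sx).
    apply: le_trans (ltW (heavy _ Vx)) _.
    rewrite [leLHS]big_mkcond [leRHS]big_mkcond; apply: ler_sum => i _.
    case: ifP => //= mi; case: ifP => //; rewrite ltNge => /negbFE rei.
    by case/negP: nty; apply/existsP; exists i; rewrite mi.
  rewrite (exchange_big_dep (fun i : 'I_N0 => e i < rho k0)) /=; last first.
    move=> x i Sx /andP[_ ei]; apply: lt_le_trans ei _; apply: rho_noninc.
    by have [/andP[]] := andP (SelP _ Sx).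
  apply: ler_sum => i _; apply: sum_at_most_one => // x y.
  move=> /andP[Sx /andP[mx ex]] /andP[Sy /andP[my ey]].
  apply/eqP; apply: contraT => xy; case/negP: (Selpair _ _ Sx Sy xy).
  apply/forallP => j; have := forallP mx j; have := forallP my j.
  have := ler_normD (cT x j - u i j) (u i j - cT y j); rewrite subrKA.
  rewrite [`|cT x j - u i j|]distrC; lra.
have WE : W * (eps * f t) = (4 * D)%N%:R ^+ m.+1 / (2 * 16 ^+ 3).
  rewrite /W /lam /step_eps -hD exprMn; field.
  by rewrite !gt_eqF ?exprn_gt0// hD.
have NN : 0 < (4 * D)%N%:R ^+ m.+1 :> R by rewrite exprn_gt0// D4E mulr_gt0.
move: cover; lra.
Qed.

(** * Iteration of the step along nested cubes *)

Lemma nested_limit (c : nat -> 'I_m.+1 -> R) (t : nat -> R) :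
  (forall n, 0 < t n) ->
  (forall n j, `|c n.+1 j - c n j| + t n.+1 <= t n) ->
  exists a : 'I_m.+1 -> R, forall n j, `|a j - c n j| <= t n.
Proof.
move=> tpos tn.
have H n d j : `|c (n + d)%N j - c n j| + t (n + d)%N <= t n.
  elim: d => [|d IH]; first by rewrite addn0 subrr normr0 add0r.
  rewrite addnS; have := tn (n + d)%N j.
  have := ler_distD (c (n + d)%N j) (c (n + d).+1 j) (c n j); lra.
have le1 l n j : c l j - t l <= c n j + t n.
  have [ln|nl] := leqP l n.
    have := H l (n - l)%N j; rewrite subnKC// => A; have := tpos n.
    have := ler_norm (c l j - c n j); rewrite distrC; lra.
  have := H n (l - n)%N j; rewrite subnKC 1?ltnW// => A; have := tpos l.
  have := ler_norm (c l j - c n j); lra.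
(* Nested intervals in each coordinate: the supremum of the left end points lies in all of them. *)
exists (fun j => sup (range (fun n => c n j - t n))) => n j.
have hs : has_sup (range (fun n => c n j - t n)).
  split; first by exists (c n j - t n); exists n.
  by exists (c n j + t n) => _ [l _ <-].
rewrite ler_distl; apply/andP; split.
  by apply: (sup_upper_bound hs); exists n.
apply: sup_le_ub; first by case: hs.
by move=> _ [l _ <-].
Qed.

Variable psi : nat -> R.
Hypothesis rho_psi : forall k q, (B ^ k < q)%N -> (q <= B ^ k.+1)%N ->
  rho k * m.+1%:R * q%:R <= psi q.

(** [step] is iterated with [K = n] at stage [n], so the levels tend to infinity and the radii to 0.
    Every hyperplane used yields one solution for the limit point. *)
Lemma avoid_from (c : 'I_m.+1 -> R) (t : R) :
  0 < t -> light f eps u e c t ->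
  exists a : 'I_m.+1 -> R,
    (forall i, ~ forall j, `|a j - u i j| <= e i) /\
    forall K, exists (x : 'rV[int]_m.+1) (p : int),
      [/\ (K < `|x ord0 ord0|)%N,
          forall j, j != ord0 -> (`|x ord0 j| < `|x ord0 ord0|)%N &
          `|dot a x - p%:~R| <= psi `|x ord0 ord0|%N].
Proof.
move=> t0 ct.
pose good (s : ('I_m.+1 -> R) * R) := 0 < s.2 /\ light f eps u e s.1 s.2.
pose Q (xn : {s | good s} * nat) (y : {s | good s}) :=
  let c := (sval xn.1).1 in let t := (sval xn.1).2 in
  let c' := (sval y).1 in
  exists k, [/\ (xn.2 <= k)%N, (sval y).2 = rho k,
    forall j, `|c' j - c j| + rho k <= t &
    exists (x : 'rV[int]_m.+1) (p : int),
    [/\ (B ^ k < `|x ord0 ord0|)%N, (`|x ord0 ord0| <= B ^ k.+1)%N,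
      forall j, j != ord0 -> (`|x ord0 j| <= B ^ k)%N & dot c' x = p%:~R]].
have HQ xn : exists y, Q xn y.
  case: xn => -[[c1 t1] /= [t1p l1]] n.
  have [c' [k [nk c't l2 xp]]] := step n t1p l1.
  have gy : good (c', rho k) by split; [exact: rho0 | exact: l2].
  by exists (exist _ (c', rho k) gy); exists k; split.
have [F HF] := choice HQ.
have g0 : good (c, t) by split.
pose fix st n : {s | good s} :=
  if n is n'.+1 then F (st n', n') else exist _ (c, t) g0.
pose cs n := (sval (st n)).1; pose ts n := (sval (st n)).2.
have tpos n : 0 < ts n by have [] := svalP (st n).
have lig n : light f eps u e (cs n) (ts n) by have [] := svalP (st n).
have Qn n : Q (st n, n) (st n.+1) by exact: HF.
have [|a Ha] := @nested_limit cs ts tpos.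
  by move=> n j; have [k [_ tk ck _]] := Qn n; rewrite /ts tk; exact: ck.
exists a; split => [i ai|K].
  have [k ke] := rho_to0 (e0 i).
  have [k' [kk' tk' _ _]] := Qn k.
  have tke : ts k.+1 <= e i.
    by rewrite /ts tk'; apply: le_trans ke; exact: rho_noninc.
  (* If the limit lay in cube [i], this cube would meet a light cube of radius at most [e i], and
     its own mass would already be too large. *)
  have : f (e i) <= eps * f (ts k.+1).
    apply: le_trans (lig k.+1 i.+1); rewrite (bigD1 ord_max)/=.
      by rewrite lerDl; apply: sumr_ge0 => j _; exact: ltW (fpos (e0 _)).
    apply/forallP => j; have := Ha k.+1 j; rewrite distrC => h1.
    have := ai j; rewrite distrC => h2; rewrite distrC in h1.
    apply: ler_distD_le h2 h1 _; exact: lexx.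
  have := fmono (ltW (tpos k.+1)) tke.
  have : eps * f (ts k.+1) < f (ts k.+1) by rewrite gtr_pMl// fpos.
  lra.
have [k [Kk tk _ [x [p [x1 x2 x3 x4]]]]] := Qn K.
exists x, p; split.
- apply: leq_ltn_trans Kk (ltn_trans (ltn_expl k B1) x1).
- by move=> j j0; apply: leq_ltn_trans (x3 j j0) x1.
- apply: le_trans (rho_psi x1 x2).
  (* Subtracting the equation of the hyperplane leaves [m.+1] terms, each at most [rho k] times the
     first coordinate of [x]. *)
  rewrite -x4 /dot -sumrB; apply: le_trans (ler_norm_sum _ _ _) _.
  apply: (@le_trans _ _ (\sum_(j < m.+1) rho k * `|x ord0 ord0|%N%:R)).
    apply: ler_sum => j _; rewrite -mulrBl normrM -intr_norm -natr_absz.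
    have xj : (`|x ord0 j| <= `|x ord0 ord0|)%N.
      have [->//|j0] := eqVneq j ord0.
      by apply: ltnW; apply: leq_ltn_trans (x3 j j0) x1.
    apply: ler_pM => //; last by rewrite ler_nat.
    by have := Ha K.+1 j; rewrite /ts tk.
  by rewrite sumr_const card_ord -[leLHS]mulr_natr mulrAC.
Qed.

(** A unit cube far out on the first axis misses the finitely many cubes before a small tail, hence
    is light. The summand [2] in its centre exceeds its radius. *)
Lemma avoid :
  exists a : 'I_m.+1 -> R,
    (forall i, ~ forall j, `|a j - u i j| <= e i) /\
    forall K, exists (x : 'rV[int]_m.+1) (p : int),
      [/\ (K < `|x ord0 ord0|)%N,
          forall j, j != ord0 -> (`|x ord0 j| < `|x ord0 ord0|)%N &
          `|dot a x - p%:~R| <= psi `|x ord0 ord0|%N].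
Proof.
have eta0 : 0 < eps * f 1 by rewrite mulr_gt0// fpos.
have [I0 HI] := summable eta0.
pose c (j : 'I_m.+1) : R :=
  if j == ord0 then \sum_(i < I0) (`|u i ord0| + e i) + 2 else 0.
apply: (@avoid_from c 1) => // N.
have far i : (i < I0)%N -> ~~ meets u e c 1 i.
  move=> iI; apply/negP => /forallP/(_ ord0); rewrite /c eqxx.
  rewrite (bigD1 (Ordinal iI))//=; set rest := \sum_(_ < _ | _) _.
  have rest0 : 0 <= rest.
    by apply: sumr_ge0 => j _; rewrite addr_ge0// ltW.
  rewrite ler_norml => /andP[+ _]; have := ler_norm (u i ord0); lra.
rewrite -(big_mkord (fun i => meets u e c 1 i) (fun i => f (e i))) big_mkcond /=.
have [NI|IN] := leqP N I0.
  rewrite big_nat big1 ?(ltW eta0)// => i /andP[_ iN].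
  by rewrite (negbTE (far _ _))// (leq_trans iN).
rewrite (big_cat_nat (n := I0)) ?(ltnW IN)//= [X in X + _]big_nat big1 ?add0r.
  apply: le_trans (HI N); apply: ler_sum => i _; case: ifP => // _.
  exact: ltW (fpos (e0 i)).
by move=> i /andP[_ iI]; rewrite (negbTE (far _ _)).
Qed.

End Step.

(** * Divergence *)

Lemma series_tail (R : realType) (b : nat -> R) (X : R) :
  (forall i, 0 <= b i) -> (forall N, \sum_(0 <= i < N) b i <= X) ->
  forall eta, 0 < eta -> exists I0, forall N, \sum_(I0 <= i < N) b i <= eta.
Proof.
move=> b0 bX eta eta0.
have hs : has_sup (range (fun N => \sum_(0 <= i < N) b i)).
  by split; [exists 0, 0%N => //; rewrite big_nil | exists X => _ [N _ <-]].
have [_ [I0 _ <-] HI] := sup_adherent eta0 hs; exists I0 => N.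
have [NI|IN] := leqP N I0; first by rewrite big_geq// ltW.
have : \sum_(0 <= i < N) b i <= sup (range (fun N => \sum_(0 <= i < N) b i)).
  by apply: (sup_upper_bound hs); exists N.
rewrite (big_cat_nat (n := I0)) ?(ltnW IN)//=; lra.
Qed.

Lemma half_series (R : realType) (N : nat) : \sum_(0 <= i < N) 2 ^- i <= 2 :> R.
Proof.
suff -> : \sum_(0 <= i < N) 2 ^- i = 2 - 2 * 2 ^- N :> R.
  by rewrite gerBl mulr_ge0// invr_ge0 exprn_ge0.
elim: N => [|N IH]; first by rewrite big_nil expr0 invr1; lra.
by rewrite big_nat_recr//= IH exprS invfM; lra.
Qed.

Lemma nneseries_partial (R : realType) (b : nat -> R) (k : nat) :
  (forall i, (k <= i)%N -> 0 <= b i) ->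
  ((\sum_(k <= i <oo) (b i)%:E)%E < +oo)%E <->
  exists X, forall N, \sum_(k <= i < N) b i <= X.
Proof.
move=> b0; have b0' i : (k <= i)%N -> true -> (0 <= (b i)%:E)%E.
  by move=> ki _; rewrite lee_fin b0.
split=> [Slt|[X HX]].
  have S0 : (0 <= \sum_(k <= i <oo) (b i)%:E)%E by exact: nneseries_ge0.
  exists (fine (\sum_(k <= i <oo) (b i)%:E)%E) => N.
  rewrite -lee_fin fineK ?ge0_fin_numE// -sumEFin.
  exact: nneseries_lim_ge.
apply: (@le_lt_trans _ _ X%:E); last exact: ltry.
apply: lime_le; first exact: is_cvg_nneseries.
by apply: nearW => N; rewrite sumEFin lee_fin.
Qed.

(** * Dimension functions, heights and diameters *)

Section DimensionFunction.
Variables (R : realType) (f : R -> R).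
Hypothesis f_dim : dimension_function f.

Lemma dimension_ge0 r : 0 <= r -> 0 <= f r.
Proof. by case: f_dim => + _ _ _; exact. Qed.

Lemma dimension_mono r s : 0 <= r -> r <= s -> f r <= f s.
Proof. by case: f_dim => _ _ + _; exact. Qed.

Lemma dimension_small e : 0 < e ->
  exists2 d, 0 < d & forall r, 0 < r -> r <= d -> f r <= e.
Proof.
move=> e0; case: f_dim => f0 _ fm /cvgrPdist_le /(_ e e0).
move=> [d /= d0 Hd]; exists (d / 2) => [|r r0 rd]; first by rewrite divr_gt0.
have := Hd r; rewrite /ball_ /= sub0r normrN gtr0_norm// => /(_ _ r0).
rewrite sub0r normrN ger0_norm; last by apply: f0; exact: ltW.
by apply; move: d0 => /= d0; lra.
Qed.

Lemma dimension_at0 : f 0 = 0.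
Proof.
apply/eqP; rewrite eq_le dimension_ge0// andbT.
apply/ler_addgt0Pl => e e0; rewrite addr0.
have [d d0 Hd] := dimension_small e0.
by apply: le_trans (Hd d d0 _) => //; apply: dimension_mono => //; exact: ltW.
Qed.

End DimensionFunction.

Lemma dist_int_le (R : realType) (t : R) (p : int) : dist_int t <= `|t - p%:~R|.
Proof. by apply: ge_inf; [exists 0 => _ [q _ <-] | exists p]. Qed.

Lemma height_first (m : nat) (x : 'rV[int]_m.+1) :
  (forall j, j != ord0 -> (`|x ord0 j| < `|x ord0 ord0|)%N) ->
  height x = `|x ord0 ord0|%N.
Proof.
move=> xj; apply/eqP; rewrite eqn_leq; apply/andP; split.
  apply/bigmax_leqP => j _; have [->//|/xj/ltnW] := eqVneq j ord0; exact.
by rewrite /height (bigD1 ord0)//= leq_max leqnn.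
Qed.

Lemma first_head_dominant (m l : nat) (x : 'rV[int]_m.+1) :
  (1 <= l)%N -> (0 < `|x ord0 ord0|)%N ->
  (forall j, j != ord0 -> (`|x ord0 j| < `|x ord0 ord0|)%N) ->
  head_dominant l x.
Proof.
move=> l1 x0 xj _.
apply: (@leq_trans `|x ord0 ord0|%N); last first.
  by rewrite (bigD1 ord0)//= leq_max leqnn.
rewrite -[ltnRHS](prednK x0) ltnS; apply/bigmax_leqP => j lj.
rewrite -ltnS prednK// xj//; apply: contraTneq lj => ->.
by rewrite leqNgt l1.
Qed.

Lemma approximable_first (R : realType) (m l : nat) (psi : nat -> R)
    (a : 'I_m.+1 -> R) :
  (1 <= l)%N ->
  (forall K, exists (x : 'rV[int]_m.+1) (p : int),
      [/\ (K < `|x ord0 ord0|)%N,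
          forall j, j != ord0 -> (`|x ord0 j| < `|x ord0 ord0|)%N &
          `|dot a x - p%:~R| <= psi `|x ord0 ord0|%N]) ->
  approximable_set l psi (\row_j a j).
Proof.
move=> l1 H; rewrite /approximable_set /= => /finite_seqP[s Hs].
(* A first coordinate beyond the sum of those in the list [s] cannot occur in [s]. *)
have [x [p [x1 x2 x3]]] := H (\sum_(y <- s) `|y ord0 ord0|)%N.
have : x \in s.
  suff : [set` s] x by [].
  rewrite -Hs /=; split.
    by apply: first_head_dominant => //; exact: leq_ltn_trans x1.
  rewrite (height_first x2); apply: le_trans (dist_int_le _ p) _.
  by under eq_bigr do rewrite mxE.
move=> xs; move: x1; rewrite (big_rem x)//= ltnNge leq_addr //.
Qed.

Lemma sup_le_euclidean (R : realType) (n : nat) (a b : 'rV[R]_n) (j : 'I_n) :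
  `|a ord0 j - b ord0 j| <= euclidean_dist a b.
Proof.
rewrite /euclidean_dist -sqrtr_sqr ler_sqrt ?sumr_ge0// => [|i _]; last exact: sqr_ge0.
rewrite (bigD1 j)//= lerDl sumr_ge0// => i _; exact: sqr_ge0.
Qed.

Lemma diam_ge0 (R : realType) (n : nat) (U : set 'rV[R]_n) : (0 <= diam U)%E.
Proof. by apply: ereal_sup_ubound; left. Qed.

Lemma le_diam (R : realType) (n : nat) (U : set 'rV[R]_n) (a b : 'rV[R]_n) :
  U a -> U b -> ((euclidean_dist a b)%:E <= diam U)%E.
Proof. by move=> Ua Ub; apply: ereal_sup_ubound; right; exists (a, b). Qed.

(** * Reduction of the divergence case to [avoid] *)

Section Divergence.
Variables (R : realType) (m l : nat) (psi : nat -> R) (f : R -> R).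
Hypothesis l_ge1 : (1 <= l)%N.
Hypothesis psi_gt0 : forall r, 0 < psi r.
Hypothesis psi_noninc : forall r s, (r <= s)%N -> psi s <= psi r.
Hypothesis f_dim : dimension_function f.
Hypothesis f_incr : forall r s : R, 0 < r -> r <= s ->
  divpow m.+1 f s <= divpow m.+1 f r.
Hypothesis g_dim : dimension_function (divpow m f).
Hypothesis Sinf :
  (\sum_(1 <= r <oo) (r%:R ^+ m.+1 * divpow m f (psi r / r%:R))%:E)%E = +oo%E.

Let term r : R := r%:R ^+ m.+1 * divpow m f (psi r / r%:R).

Let term_ge0 r : (1 <= r)%N -> 0 <= term r.
Proof.
move=> r1; rewrite mulr_ge0// (dimension_ge0 g_dim)// divr_ge0//.
exact: ltW (psi_gt0 r).
Qed.

Lemma partial_unbounded (X : R) : exists N, X <= \sum_(1 <= r < N) term r.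
Proof.
apply: contrapT => nX.
have := proj2 (nneseries_partial term_ge0); rewrite [X in (X < _)%E]Sinf ltxx.
move=> H; apply: notF; apply: H; exists X => N; apply: ltW; rewrite ltNge.
by apply/negP => XN; apply: nX; exists N.
Qed.

(** A zero of [f] would spread to smaller arguments by monotonicity and to larger ones by [f_incr];
    then all terms of the divergent series would vanish. *)
Lemma gauge_gt0 r : 0 < r -> 0 < f r.
Proof.
move=> r0; rewrite lt_neqAle (dimension_ge0 f_dim (ltW r0)) andbT eq_sym.
apply/eqP => fr0.
have fz s : 0 < s -> f s = 0.
  move=> s0; apply/eqP; rewrite eq_le (dimension_ge0 f_dim (ltW s0)) andbT.
  have [sr|/ltW rs] := leP s r.
    by rewrite -fr0 (dimension_mono f_dim)// ltW.
  have := f_incr r0 rs; rewrite /divpow fr0 mulr0.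
  by rewrite pmulr_rle0// invr_gt0 exprn_gt0.
have [N] := partial_unbounded 1.
rewrite big_nat big1 ?ler10// => r' /andP[r1 _].
by rewrite /term /divpow fz ?mulr0// divr_gt0// ltr0n.
Qed.

Let gaugeE r : divpow m f r = f r / r ^+ m.
Proof. by rewrite /divpow mulrC. Qed.

Let gmono r s : 0 < r -> r <= s -> f r / r ^+ m <= f s / s ^+ m.
Proof. by move=> r0 rs; rewrite -!gaugeE (dimension_mono g_dim)// ltW. Qed.

Let qmono r s : 0 < r -> r <= s -> f s / s ^+ m.+1 <= f r / r ^+ m.+1.
Proof. by move=> r0 rs; have := f_incr r0 rs; rewrite /divpow ![_ * f _]mulrC. Qed.

Let B := (48 * 3 ^ m.+1)%N.

Let B1 : (1 < B)%N.
Proof. by rewrite -[2%N]muln1 leq_mul// expn_gt0. Qed.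

(** [tau k] is the least value of [psi q / q] over the heights [q] of level [k]. The division by
    [m.+1] in [rho] pays for the [m.+1] terms of the linear form. *)
Let tau k : R := psi (B ^ k.+1)%N / (B ^ k.+1)%N%:R.
Let rho k : R := tau k / m.+1%:R.

Let BR : 1 < B%:R :> R. Proof. by rewrite ltr1n. Qed.

Let Bk0 k : 0 < (B ^ k)%N%:R :> R.
Proof. by rewrite ltr0n expn_gt0 (ltnW B1). Qed.

Let tau0 k : 0 < tau k. Proof. by rewrite divr_gt0. Qed.

Let rho0 k : 0 < rho k. Proof. by rewrite divr_gt0. Qed.

Let psi_div_le (r s : nat) : (0 < r)%N -> (r <= s)%N -> psi s / s%:R <= psi r / r%:R.
Proof.
move=> r0 rs; have s0 := leq_trans r0 rs.
apply: ler_pM => //; [exact: ltW (psi_gt0 _) | exact: psi_noninc |].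
by rewrite lef_pV2 ?posrE ?ltr0n ?ler_nat.
Qed.

Let rho_noninc k p : (k <= p)%N -> rho p <= rho k.
Proof.
move=> kp; rewrite ler_pM2r ?invr_gt0// /tau psi_div_le ?expn_gt0 ?(ltnW B1)//.
by rewrite leq_exp2l.
Qed.

Let rho_to0 e : 0 < e -> exists k, rho k <= e.
Proof.
move=> e0; have pe : 0 <= psi 0 / e by rewrite divr_ge0 ?ltW.
have /andP[_] := truncn_itv pe; set K := (Num.trunc _).+1 => HK; exists K.
apply: (@le_trans _ _ (tau K)); first by rewrite ler_pdivrMr// (ler_peMr (ltW (tau0 _)))// ler1n.
rewrite /tau ler_pdivrMr//; apply: (@le_trans _ _ (psi 0)); first exact: psi_noninc.
rewrite mulrC -ler_pdivrMr// ltW// (lt_le_trans HK)// ler_nat.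
by apply: ltnW; apply: leq_trans (ltn_expl K.+1 B1).
Qed.

Let level k : R := f (rho k) / rho k ^+ m / @level_gap R m B k.
Let C : R := m.+1%:R * B%:R ^+ (2 * m.+2).

(** Cauchy condensation: there are at most [B ^ k.+2] terms, each bounded by monotonicity, and the
    shift from [B ^ k] to [B ^ k.+2] is paid by the power of [B] in [C]. *)
Let block k : \sum_(B ^ k.+1 <= r < B ^ k.+2) term r <= C * level k.
Proof.
have Q0 : (0 < B ^ k.+1)%N by rewrite expn_gt0 (ltnW B1).
have g0 : 0 <= divpow m f (tau k) by apply: (dimension_ge0 g_dim); exact: ltW.
apply: (@le_trans _ _ (\sum_(B ^ k.+1 <= r < B ^ k.+2)
    (B ^ k.+2)%N%:R ^+ m.+1 * divpow m f (tau k))).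
  rewrite [leLHS]big_nat [leRHS]big_nat; apply: ler_sum => r /andP[r1 r2].
  have r0 := leq_trans Q0 r1.
  apply: ler_pM; rewrite ?exprn_ge0 ?(dimension_ge0 g_dim) ?divr_ge0 ?(ltW (psi_gt0 _))//.
    by rewrite lerXn2r ?nnegrE// ler_nat ltnW.
  apply: (dimension_mono g_dim); last exact: psi_div_le.
  by rewrite divr_ge0// ltW.
rewrite sumr_const_nat -[leLHS]mulr_natl.
apply: (@le_trans _ _ ((B ^ k.+2)%N%:R * ((B ^ k.+2)%N%:R ^+ m.+1 * divpow m f (tau k)))).
  apply: ler_wpM2r; last by rewrite ler_nat leq_subr.
  exact: mulr_ge0 (exprn_ge0 _ (ler0n _ _)) g0.
rewrite mulrA -exprS.
(* By [qmono] the ratio of [g] to its argument does not increase, so replacing [tau k] by [rho k]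
   costs a factor of at most [m.+1]. *)
have gt : divpow m f (tau k) <= m.+1%:R * (f (rho k) / rho k ^+ m).
  have rt : rho k <= tau k by rewrite ler_pdivrMr// (ler_peMr (ltW (tau0 _)))// ler1n.
  have := qmono (rho0 k) rt.
  have -> : f (rho k) / rho k ^+ m.+1 = m.+1%:R * (f (rho k) / rho k ^+ m) / tau k.
    rewrite {2}/rho exprSr; field.
    by rewrite nat1r pnatr_eq0 andbT -/(rho k) expf_neq0 gt_eqF.
  have -> : f (tau k) / tau k ^+ m.+1 = divpow m f (tau k) / tau k.
    rewrite gaugeE exprSr; field.
    by rewrite expf_neq0 gt_eqF.
  by rewrite ler_pM2r// invr_gt0.
apply: (@le_trans _ _ ((B ^ k.+2)%N%:R ^+ m.+2 * (m.+1%:R * (f (rho k) / rho k ^+ m)))).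
  by rewrite ler_wpM2l// exprn_ge0.
rewrite /C /level /level_gap invrK.
have fr0 : 0 < f (rho k) / rho k ^+ m by rewrite divr_gt0 ?exprn_gt0 ?gauge_gt0.
set X := (B * _)%N%:R; set G0 := f _ / _ in fr0 *.
have H : (B ^ k.+2)%N%:R ^+ m.+2 <= B%:R ^+ (2 * m.+2) * X.
  have -> : (B ^ k.+2)%N%:R ^+ m.+2 = B%:R ^+ (2 * m.+2) * (B ^ k)%N%:R ^+ m.+2 :> R.
    by rewrite !natrX -!exprM -exprD -mulnDl.
  rewrite ler_pM2l ?exprn_gt0 ?ltr0n ?(ltnW B1)//.
  by rewrite /X natrM !natrX ler_peMl ?exprn_ge0// ltW.
have -> : m.+1%:R * B%:R ^+ (2 * m.+2) * (G0 * X) =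
    B%:R ^+ (2 * m.+2) * X * (m.+1%:R * G0) by ring.
by rewrite ler_wpM2r// mulr_ge0// ltW.
Qed.

Let divergent k0 (X : R) : exists k1, X <= \sum_(k0 <= k < k1) level k.
Proof.
have [N HN] := partial_unbounded (C * X + \sum_(1 <= r < B ^ k0.+1) term r).
pose k1 := (k0 + N)%N; exists k1.
have C0 : 0 < C by rewrite mulr_gt0// exprn_gt0// ltr0n (ltnW B1).
have blocks p : \sum_(B ^ k0.+1 <= r < B ^ (k0 + p).+1) term r
    <= C * \sum_(k0 <= k < k0 + p) level k.
  elim: p => [|p IH]; first by rewrite addn0 !big_geq// mulr0.
  rewrite addnS (big_cat_nat (n := B ^ (k0 + p).+1)) ?leq_exp2l//; last first.
    by rewrite ltnS leq_addr.
  rewrite [in leRHS]big_nat_recr ?leq_addr//= mulrDr.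
  by apply: lerD => //; exact: block.
rewrite -(ler_pM2l C0); apply: le_trans (blocks N).
rewrite -(lerD2r (\sum_(1 <= r < B ^ k0.+1) term r)); apply: le_trans HN _.
rewrite addrC -big_cat_nat ?leq_exp2l ?expn_gt0 ?(ltnW B1)// ?ltnS ?leq_addr//.
have NB : (N <= B ^ (k0 + N).+1)%N.
  by apply: ltnW; apply: leq_trans (ltn_expl N B1) _; rewrite leq_exp2l// leqW// leq_addl.
have [N1|N0] := leqP 1 N; last first.
  rewrite [leLHS]big_geq; last by rewrite ltnW.
  rewrite big_nat; apply: sumr_ge0 => r /andP[r1 _]; exact: term_ge0.
rewrite [leRHS](big_cat_nat (n := N))//= lerDl big_nat.
by apply: sumr_ge0 => r /andP[r1 _]; apply: term_ge0; exact: leq_trans r1.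
Qed.

(** The premeasure at scale 1 is already infinite: a cover of finite cost would be contained in
    cubes that [avoid] escapes. *)
Lemma hausdorff_infinite :
  hausdorff_measure f (@approximable_set R m.+1 l psi) = +oo%E.
Proof.
suff prem : hausdorff_premeasure f 1 (@approximable_set R m.+1 l psi) = +oo%E.
  apply/eqP; rewrite -leye_eq -prem.
  by apply: ereal_sup_ubound; exists 1 => //=; exact: ltr01.
apply/ereal_inf_pinfty => _ [U [cov dU] <-] /=.
apply/eqP/negPn; rewrite -ltey; apply/negP.
pose d i := fine (diam (U i)).
have dE i : (d i)%:E = diam (U i).
  rewrite fineK// ge0_fin_numE ?diam_ge0//.
  by apply: le_lt_trans (dU i) _; exact: ltry.
have d0 i : 0 <= d i by rewrite -lee_fin dE diam_ge0.
have fd0 i : 0 <= f (d i) by exact: dimension_ge0.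
move=> /(proj1 (nneseries_partial (fun i _ => fd0 i)))[X HX].
(* Cubes must have positive radius, so a set of diameter 0 gets a small one, at a cost of at most
   [2 ^- i]. *)
have He i : exists e, [/\ 0 < e, d i <= e & f e <= f (d i) + 2 ^- i].
  have [di0|di] := eqVneq (d i) 0; last first.
    exists (d i); split => //; first by rewrite lt_neqAle eq_sym di d0.
    by rewrite lerDl invr_ge0 exprn_ge0.
  have p2 : 0 < 2 ^- i :> R by rewrite invr_gt0 exprn_gt0.
  have [e e0 He] := dimension_small f_dim p2.
  exists e; split => //; first by rewrite di0 ltW.
  by apply: le_trans (He e e0 (lexx _)) _; rewrite lerDr.
have [e He'] := choice He.
have e0 i : 0 < e i by case: (He' i).
have Hu i : exists u : 'I_m.+1 -> R, forall a, U i a -> forall j, `|a ord0 j - u j| <= e i.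
  have [[b Ub]|nU] := pselect (exists b, U i b); last first.
    by exists (fun=> 0) => a Ua; case: nU; exists a.
  exists (b ord0) => a Ua j; apply: le_trans (sup_le_euclidean a b j) _.
  by have [_ de _] := He' i; apply: le_trans de; rewrite -lee_fin dE le_diam.
have [u Hu'] := choice Hu.
have sb N : \sum_(0 <= i < N) f (e i) <= X + 2.
  apply: (@le_trans _ _ (\sum_(0 <= i < N) (f (d i) + 2 ^- i))).
    by apply: ler_sum => i _; case: (He' i).
  by rewrite big_split lerD// half_series.
have fe i : 0 <= f (e i) by apply: dimension_ge0 => //; exact: ltW.
have [||a [na xa]] := @avoid R m B f rho (leqnn _) (dimension_mono f_dim) gauge_gt0
  gmono qmono _ rho0 rho_noninc rho_to0 divergent u e e0 (series_tail fe sb) psi.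
- move=> x x0; have [y y0 Hy] := dimension_small g_dim x0; exists y => // r r0 ry.
  by rewrite -gaugeE; exact: Hy.
- move=> k q q1 q2; rewrite /rho divfK//.
  have q0 : (0 < q)%N by exact: leq_ltn_trans q1.
  by rewrite -ler_pdivlMr ?ltr0n// psi_div_le.
have Aa := approximable_first l_ge1 xa.
have [i _ Ui] := cov _ Aa.
apply: (na i) => j; have := Hu' i _ Ui j; by rewrite mxE.
Qed.

End Divergence.

(** * Convergence *)

Section FiniteCost.
Variables (R : realType) (n : nat) (f : R -> R).
Hypothesis f_dim : dimension_function f.
Implicit Types (A : set 'rV[R]_n) (d X : R).

(** This witnesses a premeasure of at most [X] at scale [d]; real partial sums keep the extended
    reals out of the estimates. *)
Definition fcover d X A : Prop :=
  exists U : nat -> set 'rV[R]_n, [/\ A `<=` \bigcup_i U i,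
    forall i, (diam (U i) <= d%:E)%E &
    forall N, \sum_(i < N) f (fine (diam (U i))) <= X].

Let cost (U : set 'rV[R]_n) : R := f (fine (diam U)).

Let cost_ge0 U : 0 <= cost U.
Proof. by apply: (dimension_ge0 f_dim); rewrite fine_ge0// diam_ge0. Qed.

Let diam_set0 : diam (set0 : set 'rV[R]_n) = 0%E.
Proof.
apply/eqP; rewrite eq_le diam_ge0 andbT; apply: ge_ereal_sup => x [->//|].
by move=> [[p q] [[]]].
Qed.

Let cost_set0 : cost set0 = 0.
Proof. by rewrite /cost diam_set0 dimension_at0. Qed.

Lemma fcover_sub d X A A' : A `<=` A' -> fcover d X A' -> fcover d X A.
Proof.
by move=> AA [U [UA dU sU]]; exists U; split => //; exact: subset_trans UA.
Qed.

(** The covers are merged along an enumeration of pairs; a partial sum of the merged cover involves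
    only pairs in a finite square. *)
Lemma fcover_bigcup d X (A : nat -> set 'rV[R]_n) (c : nat -> R) :
  0 <= d -> (forall i, fcover d (c i) (A i)) ->
  (forall N, \sum_(i < N) c i <= X) -> fcover d X (\bigcup_i A i).
Proof.
move=> d0 /choice[W HW] cX.
have [dec [decK decI]] : exists dec : nat -> option (nat * nat),
    (forall p, dec (pickle p) = Some p) /\ forall k p, dec k = Some p -> pickle p = k.
  exists pickle_inv; split => [|k p E]; first exact: pickleK_inv.
  by have := @pickle_invK (nat * nat)%type k; case: pickle_inv E => // q [->].
pose U k := if dec k is Some (i, j) then W i j else set0.
exists U; split => [a [i _ Aa]|k|N].
- have [WA _ _] := HW i; have [j _ Wa] := WA _ Aa.
  by exists (pickle (i, j)) => //; rewrite /U decK.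
- rewrite /U; case: (dec k) => [[i j]|]; first by have [_ + _] := HW i.
  by rewrite diam_set0 lee_fin.
pose size_of k := if dec k is Some (i, j) then (i + j)%N else 0%N.
pose M := (\sum_(k < N) size_of k).+1.
apply: (@le_trans _ _ (\sum_(i < M) \sum_(j < M) cost (W i j))); last first.
  apply: le_trans (cX M); apply: ler_sum => i _.
  by have [_ _] := HW i.
rewrite pair_big /=.
apply: (@le_trans _ _ (\sum_(k < N) \sum_(p : 'I_M * 'I_M)
    (pickle (p.1 : nat, p.2 : nat) == k)%:R * cost (W p.1 p.2))).
  apply: ler_sum => k _; rewrite -/(cost _) /U.
  case E : (dec k) => [[i j]|]; last first.
    by rewrite cost_set0; apply: sumr_ge0 => p _; rewrite mulr_ge0.
  have ij : (i + j < M)%N.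
    have sk : size_of k = (i + j)%N by rewrite /size_of E.
    by rewrite ltnS (bigD1 k)//= sk leq_addr.
  have iM : (i < M)%N by apply: leq_ltn_trans ij; rewrite leq_addr.
  have jM : (j < M)%N by apply: leq_ltn_trans ij; rewrite leq_addl.
  rewrite (bigD1 (Ordinal iM, Ordinal jM))//=.
  rewrite (decI _ _ E).
  by rewrite eqxx mul1r lerDl; apply: sumr_ge0 => p _; rewrite mulr_ge0.
rewrite exchange_big /=; apply: ler_sum => p _.
rewrite -mulr_suml ler_piMl// -natr_sum.
case: (ltnP (pickle (p.1 : nat, p.2 : nat)) N) => [pN|Np].
  rewrite (bigD1 (Ordinal pN))//= eqxx big1 ?addn0// => k.
  by rewrite -val_eqE /= eq_sym => /negbTE ->.
by rewrite big1 ?ler01// => k _; rewrite gtn_eqF// (leq_trans (ltn_ord k)).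
Qed.

(** Enumerate [T] and pad with empty sets, which cost [f 0 = 0]. *)
Lemma fcover_finite d s (T : finType) (W : T -> set 'rV[R]_n) A :
  0 <= s -> s <= d -> A `<=` \bigcup_t W t ->
  (forall t a b, W t a -> W t b -> euclidean_dist a b <= s) ->
  fcover d (#|T|%:R * f s) A.
Proof.
move=> s0 sd WA Ws.
have dW t : (diam (W t) <= s%:E)%E.
  apply: ge_ereal_sup => x [->|[[a b] [Wa Wb] <-]]; first by rewrite lee_fin.
  by rewrite lee_fin; exact: (Ws t _ _ Wa Wb).
exists (fun i => nth set0 [seq W t | t <- enum T] i); split => [a /WA[t _ Wa]|i|N].
- exists (index t (enum T)) => //.
  by rewrite (nth_map t) ?index_mem ?mem_enum// nth_index ?mem_enum.
- have [iT|Ti] := ltnP i (size (enum T)); last first.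
    by rewrite nth_default ?diam_set0 ?lee_fin ?(le_trans s0)// size_map.
  case E : (enum T) iT => [//|t0 r]; rewrite -E => iT.
  by rewrite (nth_map t0)// (le_trans (dW _)) ?lee_fin.
apply: (@le_trans _ _ (\sum_(i < N) if (i < #|T|)%N then f s else 0)).
  apply: ler_sum => i _; rewrite cardE; case: ltnP => [iT|Ti]; last first.
    by rewrite nth_default -?/(cost _) ?cost_set0// size_map.
  case E : (enum T) iT => [//|t0 r]; rewrite -E => iT.
  rewrite (nth_map t0)//; apply: (dimension_mono f_dim).
    by rewrite fine_ge0// diam_ge0.
  by rewrite -lee_fin fineK ?dW// ge0_fin_numE ?diam_ge0// (le_lt_trans (dW _))// ltry.
rewrite -big_mkcond /= sumr_const -[leLHS]mulr_natl ler_wpM2r ?(dimension_ge0 f_dim)//.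
rewrite ler_nat cardE -(size_map val) -[leqRHS](size_iota 0).
apply: uniq_leq_size; first by rewrite map_inj_uniq ?enum_uniq//; exact: val_inj.
by move=> x /mapP[i]; rewrite mem_enum mem_iota => iT ->.
Qed.

Lemma fcover_null A :
  (forall d X, 0 < d -> 0 < X -> fcover d X A) -> hausdorff_measure f A = 0%E.
Proof.
move=> H; apply/eqP; rewrite eq_le; apply/andP; split.
  apply: ge_ereal_sup => _ [d /= d0 <-].
  apply/lee_addgt0Pr => X X0; rewrite add0e.
  have [U [UA dU sU]] := H d X d0 X0.
  apply: ge_ereal_inf; exists (\sum_(0 <= i <oo) (cost (U i))%:E)%E.
    by exists U.
  apply: lime_le; first by apply: is_cvg_nneseries => i _ _; rewrite lee_fin.
  by apply: nearW => N; rewrite sumEFin lee_fin big_mkord.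
apply: (@le_trans _ _ (hausdorff_premeasure f 1 A)); last first.
  by apply: ereal_sup_ubound; exists 1 => //=; exact: ltr01.
apply: le_ereal_inf_tmp => _ [U _ <-]; apply: nneseries_ge0 => i _ _.
by rewrite lee_fin; exact: cost_ge0.
Qed.

End FiniteCost.

Lemma euclidean_le (R : realType) (n : nat) (a b : 'rV[R]_n) (s : R) :
  0 <= s -> (forall j, `|a ord0 j - b ord0 j| <= s) ->
  euclidean_dist a b <= n%:R * s.
Proof.
move=> s0 abs; rewrite /euclidean_dist -[leRHS]ger0_norm ?mulr_ge0//.
rewrite -sqrtr_sqr ler_wsqrtr//.
apply: (@le_trans _ _ (\sum_(i < n) s ^+ 2)).
  apply: ler_sum => i _; rewrite -[leLHS]real_normK ?num_real//.
  by rewrite lerXn2r ?nnegrE.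
rewrite sumr_const card_ord -[leLHS]mulr_natl exprMn ler_wpM2r ?exprn_ge0//.
by rewrite -natrX ler_nat; case: (n) => // k; rewrite leq_pmulr.
Qed.

(** The factor [2] makes it unnecessary to show that the infimum in [dist_int] is attained. *)
Lemma dist_int_near (R : realType) (t e : R) :
  0 < e -> dist_int t <= e -> near_int (2 * e) t.
Proof.
move=> e0 te.
have hi : has_inf [set `|t - m%:~R| | m in [set: int]].
  by split; [exists `|t - 0%:~R|, 0 | exists 0 => _ [p _ <-]].
have [_ [p _ <-] Hp] := inf_adherent e0 hi; exists p.
by apply: ltW (lt_le_trans Hp _); rewrite mulr_natl mulr2n lerD2r.
Qed.

Lemma le_height (n : nat) (x : 'rV[int]_n) (j : 'I_n) : (`|x ord0 j| <= height x)%N.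
Proof. by rewrite /height (bigD1 j)//= leq_max leqnn. Qed.

Lemma finite_height (n N : nat) : finite_set [set x : 'rV[int]_n | (height x <= N)%N].
Proof.
apply: (@sub_finite_set _ _
  [set` [seq @box_vec n N w | w <- enum {ffun 'I_n -> 'I_(2 * N).+1}]]); last first.
  by apply/finite_seqP; eexists.
move=> x /= xN; apply/mapP.
have wP i : (absz (x ord0 i + N%:Z)%R < (2 * N).+1)%N.
  have : (`|x ord0 i| <= N)%N := leq_trans (le_height x i) xN; lia.
exists [ffun i => Ordinal (wP i)]; first by rewrite mem_enum.
apply/rowP => i; rewrite mxE ffunE /= absz_shift//.
exact: leq_trans (le_height x i) xN.
Qed.

Definition level_set (R : realType) (n : nat) (psi : nat -> R) (V r : nat) :
    set 'rV[R]_n :=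
  [set a | (forall j, `|a ord0 j| <= V%:R) /\ exists x : 'rV[int]_n,
     height x = r /\ near_int (2 * psi r) (dot (a ord0) x)].

(** Otherwise all solutions would have bounded height, and only finitely many vectors do. *)
Lemma approximable_level (R : realType) (n l : nat) (psi : nat -> R) (N V : nat)
    (a : 'rV[R]_n) :
  (forall r, 0 < psi r) ->
  approximable_set l psi a -> (forall j, `|a ord0 j| <= V%:R) ->
  exists r, (N <= r)%N /\ level_set psi V r a.
Proof.
move=> psi0 Aa aV; apply: contrapT => nr; apply: Aa.
apply: sub_finite_set (finite_height n N) => x [_ xa] /=.
rewrite leqNgt; apply/negP => Nx; apply: nr; exists (height x); split; first exact: ltnW.
by split => //; exists x; split => //; exact: dist_int_near.
Qed.

Lemma signed_absz (z : int) :
  (if 0 <= z then `|z|%N%:Z else - `|z|%N%:Z) = z.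
Proof. by case: ifP; lia. Qed.

(** * Cells covering the hyperplane neighbourhoods of one height *)

Section Convergence.
Variables (R : realType) (m : nat) (psi : nat -> R) (f : R -> R).
Hypothesis psi_gt0 : forall r, 0 < psi r.
Hypothesis psi_noninc : forall r s, (r <= s)%N -> psi s <= psi r.
Hypothesis f_dim : dimension_function f.
Hypothesis f_incr : forall r s : R, 0 < r -> r <= s ->
  divpow m.+1 f s <= divpow m.+1 f r.
Hypothesis g_dim : dimension_function (divpow m f).

Let term r : R := r%:R ^+ m.+1 * divpow m f (psi r / r%:R).

Let M := (Num.trunc (2 * psi 0)).+1.
Let Cd : R := m.+1%:R * m.+4%:R.

(** The factors bound, up to powers of [r] and [psi r / r], the components of the index type [T] of
    the cells; [Cd ^+ m.+1] is the cost of replacing [f (Cd * tau)] by [f tau]. *)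
Let C (V : nat) : R :=
  m.+1%:R * 2 * 3 ^+ m * (2 * V%:R + 1) ^+ m * (2 * (m.+1 * V + M)%N%:R + 1)
  * 2 ^+ m * Cd ^+ m.+1.

Let C_ge0 V : 0 <= C V.
Proof. by rewrite !mulr_ge0 ?exprn_ge0 ?addr_ge0 ?mulr_ge0 ?exprn_ge0 ?mulr_ge0. Qed.

Let Cd_ge1 : 1 <= Cd.
Proof. by rewrite /Cd -natrM ler1n muln_gt0. Qed.

Section Level.
Variables (V r : nat).
Hypothesis r1 : (1 <= r)%N.

Let tau : R := psi r / r%:R.
Hypothesis tau_le1 : tau <= 1.

Let K := (Num.trunc tau^-1).+1.
Let P0 := (m.+1 * r * V + M)%N.

Let rR : 1 <= r%:R :> R. Proof. by rewrite ler1n. Qed.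
Let tau0 : 0 < tau. Proof. by rewrite divr_gt0// ltr0n. Qed.
Let tauE : tau * r%:R = psi r. Proof. by rewrite divfK// pnatr_eq0 -lt0n. Qed.

Let K_ge : tau^-1 < K%:R.
Proof.
have t0 : 0 <= tau^-1 by rewrite invr_ge0 ltW.
by have /andP[] := truncn_itv t0.
Qed.

Let K_le : K%:R <= 2 / tau.
Proof.
have t0 : 0 <= tau^-1 by rewrite invr_ge0 ltW.
have /andP[h _] := truncn_itv t0.
have : 1 <= tau^-1 by rewrite invf_ge1.
rewrite /K -natr1; lra.
Qed.

Let K0 : 0 < K%:R :> R. Proof. by []. Qed.

(** Every vector of height [r] has this form, with [i] an index where the height is attained and [b]
    the sign there. *)
Let vx (i : 'I_m.+1) (b : bool) (c : {ffun 'I_m -> 'I_(2 * r).+1}) : 'rV[int]_m.+1 :=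
  \row_k (if unlift i k is Some j then (c j)%:Z - r%:Z
          else if b then r%:Z else - r%:Z).

Let T := ('I_m.+1 * bool * {ffun 'I_m -> 'I_(2 * r).+1} *
  {ffun 'I_m -> 'I_(2 * V * K).+1} * 'I_(2 * P0).+1)%type.

(** The other coordinates are fixed up to [1 / K] and the form up to [2 * psi r]; as coordinate [i]
    has coefficient [r] or [-r], it is then fixed up to the order of [psi r / r]. *)
Let cell (t : T) : set 'rV[R]_m.+1 :=
  let: (i, b, c, q, p) := t in
  [set a | (forall j, - V%:R + (q j)%:R / K%:R <= a ord0 (lift i j)
              <= - V%:R + ((q j)%:R + 1) / K%:R) /\
           `|dot (a ord0) (vx i b c) - (p%:R - P0%:R)| <= 2 * psi r].

Let dot_vx (a : 'rV[R]_m.+1) i b c : dot (a ord0) (vx i b c) =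
  a ord0 i * (if b then r%:R else - r%:R) +
  \sum_j a ord0 (lift i j) * ((c j)%:R - r%:R).
Proof.
rewrite /dot (bigD1_ord i)//= !mxE unlift_none; congr (_ + _).
  by case: b; rewrite ?mulrNz.
apply: eq_bigr => j _; by rewrite !mxE liftK intrB.
Qed.

(** In coordinate [i], the two values of the form account for [4 * tau] and the other coordinates
    for [m%:R * tau]; the factor [m.+1] in [Cd] passes from the sup norm to the Euclidean
    distance. *)
Let cell_diam t (a b : 'rV[R]_m.+1) :
  cell t a -> cell t b -> euclidean_dist a b <= Cd * tau.
Proof.
case: t => [[[[i s] c] q] p] [a1 a2] [b1 b2].
rewrite /Cd -mulrA; apply: euclidean_le => [|k].
  by rewrite mulr_ge0// ltW.
have Ktau : K%:R^-1 <= tau.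
  by rewrite -[leRHS]invrK lef_pV2 ?posrE ?invr_gt0// ltW.
have lft j : `|a ord0 (lift i j) - b ord0 (lift i j)| <= tau.
  have /andP[h1 h2] := a1 j; have /andP[h3 h4] := b1 j.
  rewrite mulrDl mul1r in h2 h4.
  rewrite ler_norml; apply/andP; split; lra.
case: (unliftP i k) => [j|] ->.
  by apply: le_trans (lft j) _; rewrite ler_peMl ?(ltW tau0)// ler1n.
set e : R := if s then r%:R else - r%:R.
have en : `|e| = r%:R by rewrite /e; case: (s); rewrite ?normrN normr_nat.
set sum := \sum_j (a ord0 (lift i j) - b ord0 (lift i j)) * ((c j)%:R - r%:R).
have sumle : `|sum| <= m%:R * (tau * r%:R).
  apply: le_trans (ler_norm_sum _ _ _) _.
  apply: (@le_trans _ _ (\sum_(j < m) tau * r%:R)); last first.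
    by rewrite sumr_const card_ord -[leLHS]mulr_natl.
  apply: ler_sum => j _; rewrite normrM; apply: ler_pM => //.
  have cj : (c j)%:R <= 2 * r%:R :> R by rewrite -natrM ler_nat -ltnS ltn_ord.
  have c0 : 0 <= (c j)%:R :> R by [].
  by rewrite ler_norml; apply/andP; split; lra.
have E : (a ord0 i - b ord0 i) * e =
    (dot (a ord0) (vx i s c) - (p%:R - P0%:R)) -
    (dot (b ord0) (vx i s c) - (p%:R - P0%:R)) - sum.
  have -> : sum = \sum_j a ord0 (lift i j) * ((c j)%:R - r%:R) -
      \sum_j b ord0 (lift i j) * ((c j)%:R - r%:R).
    by rewrite -sumrB; apply: eq_bigr => j _; rewrite mulrBl.
  by rewrite !dot_vx -/e; ring.
have : `|a ord0 i - b ord0 i| * r%:R <= m.+4%:R * tau * r%:R.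
  rewrite -en -normrM E; apply: le_trans (ler_normB _ _) _.
  have := ler_normB (dot (a ord0) (vx i s c) - (p%:R - P0%:R))
    (dot (b ord0) (vx i s c) - (p%:R - P0%:R)).
  rewrite -[m.+4]addn4 natrD en -tauE in a2 b2 *; lra.
by rewrite ler_pM2r// ltr0n.
Qed.

Let cell_cover : level_set psi V r `<=` \bigcup_t cell t.
Proof.
move=> a [aV [x [hx [p Hp]]]].
have [|i Hi] := @bigop.eq_bigmax 'I_m.+1 (fun j => `|x ord0 j|%N); first by rewrite card_ord.
have xi : `|x ord0 i|%N = r by rewrite -hx /height Hi.
have xr j : (`|x ord0 j| <= r)%N by rewrite -hx le_height.
have cP j : (absz (x ord0 (lift i j) + r%:Z)%R < (2 * r).+1)%N.
  have := xr (lift i j); lia.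
pose c := [ffun j => Ordinal (cP j)].
have aK0 j : 0 <= (a ord0 j + V%:R) * K%:R.
  by rewrite mulr_ge0//; have := aV j; rewrite ler_norml => /andP[]; lra.
have qP j : (Num.trunc ((a ord0 (lift i j) + V%:R) * K%:R) < (2 * V * K).+1)%N.
  rewrite ltnS -(ler_nat R); have /andP[+ _] := truncn_itv (aK0 (lift i j)).
  move=> /le_trans; apply; rewrite !natrM ler_wpM2r//.
  by have := aV (lift i j); rewrite ler_norml => /andP[]; lra.
pose q := [ffun j => Ordinal (qP j)].
have vxE : vx i (0 <= x ord0 i :> int) c = x.
  apply/rowP => k; rewrite mxE; case: unliftP => [j|] ->.
    by rewrite ffunE /=; exact: absz_shift (xr _).
  by rewrite -[r]xi; exact: signed_absz.
have dot_le : `|dot (a ord0) x| <= (m.+1 * r * V)%N%:R.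
  apply: le_trans (ler_norm_sum _ _ _) _.
  apply: (@le_trans _ _ (\sum_(j < m.+1) V%:R * r%:R)).
    apply: ler_sum => j _; rewrite normrM -intr_norm -natr_absz.
    by apply: ler_pM => //; rewrite ler_nat.
  by rewrite sumr_const card_ord -[leLHS]mulr_natl !natrM [V%:R * _]mulrC mulrA.
have M_ge : 2 * psi r <= M%:R.
  have p0 : 0 <= 2 * psi 0 by rewrite mulr_ge0// ltW.
  have /andP[_ /ltW] := truncn_itv p0; apply: le_trans.
  by rewrite ler_pM2l// psi_noninc.
have pP : (`|p| <= P0)%N.
  rewrite -(ler_nat R) natr_absz intr_norm /P0 natrD.
  have := ler_normD (p%:~R - dot (a ord0) x) (dot (a ord0) x); rewrite subrK distrC; lra.
have pP' : (absz (p + P0%:Z)%R < (2 * P0).+1)%N by lia.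
exists (i, (0 <= x ord0 i :> int), c, q, Ordinal pP') => //; split => [j|].
  rewrite ffunE /=; have /andP[h1 h2] := truncn_itv (aK0 (lift i j)).
  rewrite -natr1 in h2.
  have e1 : (Num.trunc ((a ord0 (lift i j) + V%:R) * K%:R))%:R / K%:R
      <= a ord0 (lift i j) + V%:R by rewrite ler_pdivrMr.
  have e2 : a ord0 (lift i j) + V%:R
      <= ((Num.trunc ((a ord0 (lift i j) + V%:R) * K%:R))%:R + 1) / K%:R.
    by rewrite ler_pdivlMr// ltW.
  by apply/andP; split; lra.
rewrite vxE /=.
have -> : (absz (p + P0%:Z)%R)%:R - P0%:R = p%:~R :> R.
  by rewrite -[p in RHS](absz_shift pP) intrB.
exact: Hp.
Qed.

(** There are about [r ^ m.+1 / tau ^ m] cells, and [f_incr] bounds the cost of each by a constant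
    times [f tau]. *)
Lemma level_cover d : Cd * tau <= d -> fcover f d (C V * term r) (@level_set R m.+1 psi V r).
Proof.
move=> Cdd.
have [U [UA dU sU]] : fcover f d (#|{: T}|%:R * f (Cd * tau)) (@level_set R m.+1 psi V r).
  apply: (fcover_finite f_dim (W := cell)) Cdd cell_cover cell_diam.
  by rewrite mulr_ge0 ?(ltW tau0)// (le_trans _ Cd_ge1).
exists U; split => // N; apply: le_trans (sU N) _.
have ft0 : 0 <= f tau by apply: (dimension_ge0 f_dim); exact: ltW.
have fC : f (Cd * tau) <= Cd ^+ m.+1 * f tau.
  have := f_incr tau0 (ler_peMl (ltW tau0) Cd_ge1).
  have A0 : 0 < Cd ^+ m.+1 by rewrite exprn_gt0// (lt_le_trans _ Cd_ge1).
  have B0 : 0 < tau ^+ m.+1 by rewrite exprn_gt0.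
  rewrite /divpow exprMn ler_pdivrMl ?mulr_gt0//.
  by rewrite -[leRHS]mulrA mulVKf// gt_eqF.
have cT : #|{: T}|%:R <= m.+1%:R * 2 * (3 * r%:R) ^+ m * ((2 * V%:R + 1) * (2 / tau)) ^+ m
    * ((2 * (m.+1 * V + M)%N%:R + 1) * r%:R).
  rewrite !card_prod card_bool !card_ffun !card_ord !natrM !natrX.
  apply: ler_pM => //.
    apply: ler_pM => //.
      apply: ler_pM => //.
      have e3 : (2 * r).+1%:R <= 3 * r%:R :> R by rewrite -natrM ler_nat; lia.
      by rewrite lerXn2r ?nnegrE ?mulr_ge0.
    have eV : (2 * V * K).+1%:R = 2 * V%:R * K%:R + 1 :> R by rewrite -!natrM natr1.
    rewrite lerXn2r ?nnegrE ?mulr_ge0 ?addr_ge0 ?invr_ge0 ?(ltW tau0)// eV.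
    apply: (@le_trans _ _ ((2 * V%:R + 1) * K%:R)).
      have : 1 <= K%:R :> R by rewrite ler1n.
      lra.
    by rewrite ler_wpM2l// addr_ge0.
  have -> : (2 * P0).+1%:R = 2 * (m.+1%:R * r%:R * V%:R + M%:R) + 1 :> R.
    by rewrite -!natrM -natrD -natrM natr1.
  rewrite natrD natrM.
  have : 0 <= M%:R * (r%:R - 1) :> R by rewrite mulr_ge0// subr_ge0.
  move: rR; move: (m.+1%:R : R) (r%:R : R) (V%:R : R) (M%:R : R) => w x y z; nra.
apply: le_trans (ler_pM _ _ cT fC) _ => //.
  apply: (dimension_ge0 f_dim); rewrite mulr_ge0 ?(ltW tau0)// (le_trans _ Cd_ge1)//.
rewrite le_eqVlt; apply/orP; left; apply/eqP.
rewrite /C /term /divpow -/tau [(3 * _) ^+ m]exprMn [(_ * (2 / _)) ^+ m]exprMn.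
rewrite [(2 / _) ^+ m]expr_div_n [r%:R ^+ m.+1]exprS.
ring.
Qed.

End Level.

(** * Summation over the heights and over the boxes *)

Hypothesis Sfin :
  ((\sum_(1 <= r <oo) (r%:R ^+ m.+1 * divpow m f (psi r / r%:R))%:E)%E < +oo)%E.
Variable l : nat.

Let term_ge0 r : (1 <= r)%N -> 0 <= term r.
Proof.
move=> r1; rewrite mulr_ge0// (dimension_ge0 g_dim)// divr_ge0//.
exact: ltW (psi_gt0 r).
Qed.

Lemma box_cover (V : nat) d X : 0 < d -> 0 < X ->
  fcover f d X [set a : 'rV[R]_m.+1 |
    approximable_set l psi a /\ forall j, `|a ord0 j| <= V%:R].
Proof.
move=> d0 X0.
have [Y HY] := proj1 (nneseries_partial term_ge0) Sfin.
have b0 i : 0 <= term i.+1 by exact: term_ge0.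
have bY N : \sum_(0 <= i < N) term i.+1 <= Y.
  apply: le_trans (HY N.+1); rewrite le_eqVlt; apply/orP; left.
  by rewrite big_add1.
have CV1 : 0 < C V + 1 by rewrite ltr_wpDl ?C_ge0.
have [I0 HI] := series_tail b0 bY (divr_gt0 X0 CV1).
have Cd0 : 0 < Cd by apply: lt_le_trans Cd_ge1.
have u0 : 0 <= psi 0 * (1 + Cd / d).
  by rewrite mulr_ge0 ?(ltW (psi_gt0 0))// addr_ge0// divr_ge0// ltW.
(* Beyond [p] the tail of the series is small enough, [psi r / r <= 1], and the cells have diameter
   at most [d]. *)
pose p := (I0 + (Num.trunc (psi 0 * (1 + Cd / d))).+1)%N.
have small r : (p < r)%N -> psi r / r%:R <= 1 /\ Cd * (psi r / r%:R) <= d.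
  move=> pr; have r0 : 0 < r%:R :> R by rewrite ltr0n (leq_trans _ pr).
  have /andP[_ ub] := truncn_itv u0.
  have ur : psi 0 * (1 + Cd / d) <= r%:R.
    by apply: ltW (lt_le_trans ub _); rewrite ler_nat (leq_trans _ (ltnW pr))// leq_addl.
  have pr0 : psi r <= psi 0 by exact: psi_noninc.
  have pos : 0 <= psi 0 * (Cd / d).
    by rewrite mulr_ge0 ?(ltW (psi_gt0 0))// divr_ge0// ltW.
  split; first by rewrite ler_pdivrMr// mul1r; lra.
  rewrite mulrA ler_pdivrMr//; apply: (@le_trans _ _ (psi 0 * Cd)).
    by rewrite mulrC ler_pM2r.
  have h : psi 0 * (Cd / d) <= r%:R by have := psi_gt0 0; lra.
  by move: h; rewrite mulrA ler_pdivrMr// [_ * d]mulrC.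
apply: (@fcover_sub _ _ _ _ _ _ (\bigcup_i level_set psi V (i + p.+1)%N)).
  move=> a [Aa aV]; have [r [pr ra]] := approximable_level p.+1 psi_gt0 Aa aV.
  by exists (r - p.+1)%N => //; rewrite subnK.
apply: (fcover_bigcup f_dim (c := fun i => C V * term (i + p.+1)%N) (ltW d0)).
  move=> i; have [t1 t2] := small (i + p.+1)%N (leq_addl _ _).
  by apply: level_cover => //; rewrite addnS.
move=> N; rewrite -mulr_sumr.
have tail : \sum_(i < N) term (i + p.+1)%N <= X / (C V + 1).
  apply: le_trans (HI (N + p)%N).
  rewrite -(big_mkord xpredT (fun i => term (i + p.+1)%N)).
  rewrite (eq_bigr (fun i => term (i + p).+1)) => [|i _]; last by rewrite addnS.
  rewrite -{1}[N](addnK p) -(big_addn 0 _ p xpredT (fun i => term i.+1)) add0n.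
  rewrite [leRHS](big_cat_nat (n := p)) ?leq_addr ?leq_addl//= lerDr.
  by apply: sumr_ge0 => i _.
apply: le_trans (ler_wpM2l (C_ge0 V) tail) _.
by rewrite mulrCA ger_pMr// ler_pdivrMr// mul1r lerDl.
Qed.

(** The boxes of half-side [V] exhaust the space; the one with index [V] is covered at cost
    [X / 2 * 2 ^- V]. *)
Lemma hausdorff_zero : hausdorff_measure f (@approximable_set R m.+1 l psi) = 0%E.
Proof.
apply: (fcover_null f_dim) => d X d0 X0.
pose A (V : nat) := [set a : 'rV[R]_m.+1 |
    approximable_set l psi a /\ forall j, `|a ord0 j| <= V%:R].
apply: (@fcover_sub _ _ _ _ _ _ (\bigcup_V A V)).
  move=> a Aa.
  have s0 : 0 <= \sum_j `|a ord0 j| by apply: sumr_ge0.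
  exists (Num.trunc (\sum_j `|a ord0 j|)).+1 => //; split => // j.
  have /andP[_ /ltW] := truncn_itv s0; apply: le_trans.
  by rewrite (bigD1 j)//= lerDl sumr_ge0.
apply: (fcover_bigcup f_dim (c := fun V => X / 2 * 2 ^- V) (ltW d0)).
  move=> V; apply: box_cover => //.
  by rewrite mulr_gt0 ?divr_gt0 ?invr_gt0 ?exprn_gt0.
move=> N; rewrite -mulr_sumr -[leRHS](divfK (_ : 2 != 0 :> R))//.
rewrite ler_wpM2l ?divr_ge0 ?(ltW X0)//.
by rewrite -(big_mkord xpredT (fun V => 2 ^- V)) half_series.
Qed.

End Convergence.

(* MathComp world, MathComp-Analysis.  In [f_incr] "increasing" is meant as r
   decreases to 0, in the weak sense. *)
Theorem theorem5 (R : realType) (n l : nat) (l_ge1 : (1 <= l)%N)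
    (l_le_n : (l <= n)%N)
    (psi : nat -> R)
    (psi_gt0 : forall r, 0 < psi r)
    (psi_noninc : forall r s, (r <= s)%N -> psi s <= psi r)
    (f : R -> R)
    (f_dim : dimension_function f)
    (f_incr : forall r s, 0 < r -> r <= s -> divpow n f s <= divpow n f r)
    (g_dim : dimension_function (divpow n.-1 f)) :
  let S := (\sum_(1 <= r <oo)
              (r%:R ^+ n * divpow n.-1 f (psi r / r%:R))%:E)%E in
  ((S < +oo)%E -> hausdorff_measure f (approximable_set (n := n) l psi) = 0%E)
  /\
  (S = +oo%E -> hausdorff_measure f (approximable_set (n := n) l psi) = +oo%E).
Proof.
case: n l_le_n f_incr g_dim => [|m] l_le_n f_incr g_dim S.
  by move: l_ge1; rewrite leqNgt ltnS l_le_n.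
by split => HS; [exact: hausdorff_zero | exact: hausdorff_infinite].
Qed.
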